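(* For every non-negative integer $k$, the connected graphs in $\mathbf{obs}(\mathcal{A}_k(\mathcal{S}))\cap\mathcal{K}$ are exactly the graphs in $\mathcal{Z}_{k+1}$ (up to isomorphism).
   Context: All graphs are finite, undirected, without loops or multiple edges, and are considered up to isomorphism. A graph $H$ is a minor of $G$ if $H$ can be obtained from some subgraph of $G$ by contracting edges; it is proper if not isomorphic to $G$. A graph is sub-unicyclic if it contains at most one cycle; $\mathcal{S}$ is the class of sub-unicyclic graphs. $\mathcal{A}_k(\mathcal{S})$ is the class of graphs $G$ for which some set of at most $k$ vertices can be removed to give a graph in $\mathcal{S}$. For a class $\mathcal{G}$, $\mathbf{obs}(\mathcal{G})$ is the set of minor-minimal graphs not in $\mathcal{G}$. $\mathcal{K}$ is the class of cactus graphs: graphs all of whose blocks are edges or cycles (equivalently, graphs with no $K_4^-$ minor, where $K_4^-$ is $K_4$ minus an edge). The butterfly graph $Z$ is obtained from two disjoint triangles by identifying a vertex of one with a vertex of the other; its central vertex is its vertex of degree 4, and its four vertices of degree 2 are its extremal vertices. The class $\mathcal{Z}_k$ of $k$-butterfly-cacti is defined recursively: $\mathcal{Z}_1=\{Z\}$; for $k\ge 2$, $G\in\mathcal{Z}_k$ if there is $G'\in\mathcal{Z}_{k-1}$ such that $G$ is obtained by taking a new copy of $Z$ and identifying one of its extremal vertices with a non-central vertex of $G'$. The central vertices of the resulting $G$ are the central vertices of $G'$ together with the central vertex of the new copy of $Z$. *)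

(* Defs.v *)
From mathcomp Require Import all_boot.

Set Implicit Arguments.
Unset Strict Implicit.
Unset Printing Implicit Defensive.

Record sgraph := SGraph {
  svertex :> finType;
  sedge : rel svertex;
  sedge_sym : symmetric sedge;
  sedge_irrefl : irreflexive sedge }.

Notation "x -- y" := (sedge x y) (at level 30).

Definition graph_class := sgraph -> Prop.

Definition graph_iso (G H : sgraph) : Prop :=
  exists2 f : G -> H, bijective f & forall x y, (f x -- f y) = (x -- y).

Definition complete_edge n : rel 'I_n := fun i j => i != j.

Lemma complete_edge_sym n : symmetric (@complete_edge n).
Proof. by move=> i j; rewrite /complete_edge eq_sym. Qed.

Lemma complete_edge_irrefl n : irreflexive (@complete_edge n).
Proof. by move=> i; rewrite /complete_edge eqxx. Qed.

Definition complete_graph n : sgraph :=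
  SGraph (@complete_edge_sym n) (@complete_edge_irrefl n).

(* Only lengths at least 3 give simple cycles, so [cycle_graph n] is the cycle
   on n + 3 vertices; [ordS] is the cyclic successor. *)
Definition cycle_edge n : rel 'I_n.+3 :=
  fun i j => (j == ordS i) || (i == ordS j).

Lemma cycle_edge_sym n : symmetric (@cycle_edge n).
Proof. by move=> i j; rewrite /cycle_edge orbC. Qed.

Lemma cycle_edge_irrefl n : irreflexive (@cycle_edge n).
Proof.
move=> i; rewrite /cycle_edge orbb -val_eqE /=; apply/negbTE.
have := ltn_ord i; rewrite leq_eqVlt eqSS => /orP[/eqP-> | lt_i].
  by rewrite modnn.
by rewrite modn_small // ltn_eqF.
Qed.

Definition cycle_graph n : sgraph :=
  SGraph (@cycle_edge_sym n) (@cycle_edge_irrefl n).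

Section Operations.
Variable G : sgraph.

Definition induced_edge (A : {set G}) : rel {x : G | x \in A} :=
  fun u v => val u -- val v.

Lemma induced_edge_sym A : symmetric (@induced_edge A).
Proof. by move=> u v; apply: sedge_sym. Qed.

Lemma induced_edge_irrefl A : irreflexive (@induced_edge A).
Proof. by move=> u; apply: sedge_irrefl. Qed.

Definition induced A : sgraph :=
  SGraph (@induced_edge_sym A) (@induced_edge_irrefl A).

Definition delete (A : {set G}) : sgraph := induced (~: A).

(* The vertex resulting from the contraction of the edge x -- y is named x. *)
Definition contract_edge (x y : G) : rel {z : G | z != y} :=
  fun u v => (u != v) &&
    [|| val u -- val v, (val u == x) && (y -- val v)
      | (val v == x) && (y -- val u)].

Lemma contract_edge_sym x y : symmetric (@contract_edge x y).
Proof.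
move=> u v; rewrite /contract_edge eq_sym sedge_sym.
by congr (_ && (_ || _)); rewrite orbC.
Qed.

Lemma contract_edge_irrefl x y : irreflexive (@contract_edge x y).
Proof. by move=> u; rewrite /contract_edge eqxx. Qed.

Definition contract x y : sgraph :=
  SGraph (@contract_edge_sym x y) (@contract_edge_irrefl x y).

Definition degree (x : G) : nat := #|[set y | x -- y]|.

Definition connected : Prop :=
  0 < #|G| /\ forall x y : G, connect (@sedge G) x y.

Definition n_components : nat := n_comp (@sedge G) G.

End Operations.

(* Disjoint union of G and H with y : H identified with x : G; the common
   vertex is named [inl x]. *)
Definition glue_edge (G H : sgraph) (x : G) (y : H) :
    rel (G + {z : H | z != y}) :=
  fun u v => match u, v with
    | inl a, inl b => a -- b
    | inr a, inr b => val a -- val b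
    | inl a, inr b => (a == x) && (y -- val b)
    | inr a, inl b => (b == x) && (y -- val a)
    end.

Lemma glue_edge_sym (G H : sgraph) (x : G) (y : H) :
  symmetric (@glue_edge G H x y).
Proof. by case=> a [] b //=; apply: sedge_sym. Qed.

Lemma glue_edge_irrefl (G H : sgraph) (x : G) (y : H) :
  irreflexive (@glue_edge G H x y).
Proof. by case=> a /=; apply: sedge_irrefl. Qed.

Definition glue (G H : sgraph) (x : G) (y : H) : sgraph :=
  SGraph (@glue_edge_sym G H x y) (@glue_edge_irrefl G H x y).

(* H is, up to isomorphism, a not necessarily induced subgraph of G. *)
Definition subgraph (H G : sgraph) : Prop :=
  exists2 f : H -> G, injective f & {homo f : x y / x -- y}.

Inductive contracts_to : sgraph -> sgraph -> Prop :=
| contracts_iso (G H : sgraph) : graph_iso G H -> contracts_to G H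
| contracts_step (G H : sgraph) (x y : G) :
    x -- y -> contracts_to (contract x y) H -> contracts_to G H.

Definition minor (H G : sgraph) : Prop :=
  exists2 G' : sgraph, subgraph G' G & contracts_to G' H.

Definition proper_minor (H G : sgraph) : Prop := minor H G /\ ~ graph_iso H G.

Definition obs (C : graph_class) : graph_class :=
  fun G => ~ C G /\ forall H, proper_minor H G -> C H.

Definition is_cycle (G : sgraph) (c : seq G) : Prop :=
  2 < size c /\ ucycle (@sedge G) c.

(* Two sequences describe the same cycle when they agree up to rotation and
   reversal, that is, when they have the same set of edges. *)
Definition cycle_edges (G : sgraph) (c : seq G) : {set {set G}} :=
  [set [set x; next c x] | x in c].

Definition sub_unicyclic : graph_class :=
  fun G => forall c1 c2 : seq G,
    is_cycle c1 -> is_cycle c2 -> cycle_edges c1 = cycle_edges c2.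

Definition apex (k : nat) (C : graph_class) : graph_class :=
  fun G => exists2 A : {set G}, #|A| <= k & C (delete A).

Definition cutvertex (G : sgraph) (x : G) : Prop :=
  n_components G < n_components (delete [set x]).

Definition nonseparable (G : sgraph) : Prop :=
  connected G /\ forall x : G, ~ cutvertex x.

(* A block is a maximal connected subgraph without a cutvertex of its own.
   Such a subgraph is induced, so it is given by its vertex set. *)
Definition block (G : sgraph) (B : {set G}) : Prop :=
  nonseparable (induced B) /\
  forall B' : {set G}, B \subset B' -> nonseparable (induced B') -> B' = B.

(* An isolated vertex is a block by itself, and is allowed in a cactus. *)
Definition cactus : graph_class :=
  fun G => forall B : {set G}, block B ->
    [\/ graph_iso (induced B) (complete_graph 1),
        graph_iso (induced B) (complete_graph 2)
      | exists n, graph_iso (induced B) (cycle_graph n)].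

Definition butterfly : sgraph :=
  @glue (complete_graph 3) (complete_graph 3) ord0 ord0.

Definition butterfly_central : {set butterfly} := [set x | degree x == 4].
Definition butterfly_extremal : {set butterfly} := [set x | degree x == 2].

(* The central vertices are recorded along the construction. *)
Record marked_graph := MarkedGraph {
  mgraph :> sgraph;
  central : {set mgraph} }.

Definition marked_butterfly : marked_graph := MarkedGraph butterfly_central.

Definition attach_butterfly (M : marked_graph) (v : M) (x : butterfly) :
    marked_graph :=
  @MarkedGraph (glue v x)
    [set u : M + {z : butterfly | z != x} | match u with
      | inl a => a \in central M
      | inr b => val b \in butterfly_central
      end].

Inductive butterfly_construction : nat -> marked_graph -> Prop :=
| construction_base : butterfly_construction 1 marked_butterfly
| construction_step k (M : marked_graph) (v : M) (x : butterfly) :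
    butterfly_construction k M -> v \notin central M ->
    x \in butterfly_extremal ->
    butterfly_construction k.+1 (attach_butterfly v x).

Definition butterfly_cactus (k : nat) : graph_class :=
  fun G => exists2 M : marked_graph,
    butterfly_construction k M & graph_iso G M.

(* Main.v *)
Require Import Defs.
From mathcomp Require Import all_boot.
From mathcomp Require Import zify.
From Stdlib Require Import Classical.

Set Implicit Arguments.
Unset Strict Implicit.
Unset Printing Implicit Defensive.

(** The graphs in [Z_(k+1)] are the trees of k + 1 butterflies glued along
    non-central vertices. The forward direction rests on one inequality: in a
    cactus two cycles share at most one vertex, and removing an edge from each
    cycle of a family leaves a forest, so the vertex sets T of a nonempty family
    of m cycles satisfy sum |T| < |union| + m. Counting with it gives a leaf
    cycle in every family, hence a hitting set A and a packing of the cycles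
    with |A| = |packing|. In a connected obstruction this common value is k + 1:
    a packing of k + 2 cycles survives the deletion of an edge between two
    cycles. As A minus v never suffices, each v in A lies on two cycles that avoid
    the rest of A, a butterfly centred at v. Any system of k + 1 such butterflies
    is, again by counting, outside the class; so by minimality the butterflies
    contain all edges and all their cycles are triangles, and adding one
    adjacent butterfly at a time rebuilds G as an element of [Z_(k+1)].

    Conversely every cycle of a graph in [Z_(k+1)] is a triangle with exactly
    one centre, and the only set of at most k + 1 vertices hitting all cycles is
    the set of centres, so the graph is outside the class. An edge lies in
    a triangle; removing all centres but the one of that triangle leaves two
    triangles, one of which is destroyed by deleting or contracting the edge. *)

(** * Cycles *)

(** [hyperforest] constrains a family of vertex sets and mentions no graph. This is what makes
    minimality usable: after an edge is deleted or contracted, it is enough that the k + 1 pairs of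
    sets are still vertex sets of cycles and still satisfy the inequality, and nothing has to be
    known about the blocks of the new graph. Deletion leaves the sets unchanged; only contraction
    needs a recount. Cycles are compared by edge sets, but families consist of vertex sets. Both
    directions of this change of viewpoint are needed: equal edge sets always give equal vertex
    sets, and the converse holds for cycles that share two vertices in a cactus and for triangles in
    any graph. In the assembly no tree shape is known beforehand. It comes out of a tight count: m
    butterflies cover at least 4m + 1 vertices, and growing along edges of a connected graph never
    covers more. For the converse, being outside the class is too weak to pass through a gluing; the
    uniqueness of the smallest hitting set is the statement that passes. *)

Fixpoint path_edges (T : finType) (x : T) (p : seq T) : {set {set T}} :=
  if p is y :: q then [set x; y] |: path_edges y q else set0.

Section PathEdges.
Variables T : finType.
Implicit Types (x y z : T) (p : seq T).

Lemma path_edges_rcons x p z :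
  path_edges x (rcons p z) = [set last x p; z] |: path_edges x p.
Proof.
elim: p x => [|y p IHp] x //=.
by rewrite IHp !setUA [_ |: [set _]]setUC.
Qed.

Lemma path_edges_map (U : finType) (f : T -> U) x p :
  path_edges (f x) (map f p) = [set f @: (e : {set T}) | e in path_edges x p].
Proof.
elim: p x => [|y p IHp] x /=; first by rewrite imset0.
by rewrite IHp imsetU1 imsetU1 imset_set1.
Qed.

(** The closing vertex [z] is kept apart from the start [x], because the recursion of [next_at]
    moves the start while its default stays. With [z := x] this turns [cycle_edges], defined through
    [next], into the edges of a closed walk, which suit induction and [map]. *)
Lemma next_at_edges z x p : uniq (x :: p) ->
  [set [set y; next_at y z x p] | y in x :: p] = path_edges x (rcons p z).
Proof.
elim: p x => [|y p IHp] x.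
  move=> _ /=; rewrite setU0; apply/setP=> e; rewrite inE.
  apply/imsetP/eqP => [[u]|->].
    by rewrite inE => /eqP->; rewrite eqxx.
  by exists x; rewrite ?mem_head ?eqxx.
rewrite cons_uniq => /andP[xNp Up]; rewrite rcons_cons -[RHS]/([set x; y] |: path_edges y (rcons p z)).
rewrite -IHp //; apply/setP=> e; rewrite in_setU1; apply/imsetP/orP.
  case=> u; rewrite inE => /predU1P[-> -> | up ->]; first by rewrite /= eqxx; left.
  right; apply/imsetP; exists u => //=.
  by case: eqP up xNp => // -> ->.
case=> [/eqP-> | /imsetP[u up ->]]; first by exists x; rewrite ?mem_head //= eqxx.
exists u; first by rewrite inE up orbT.
by rewrite /=; case: eqP up xNp => // -> ->.
Qed.

End PathEdges.

Section Cycles.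
Variable G : sgraph.
Implicit Types (x y z : G) (c p : seq G) (X : {set G}).

Lemma cycle_edges_cons x p : uniq (x :: p) ->
  cycle_edges (x :: p) = path_edges x (rcons p x).
Proof. exact: next_at_edges. Qed.

Lemma cycle_edges_cons2 x y p : uniq [:: x, y & p] ->
  cycle_edges [:: x, y & p] =
  [set x; y] |: ([set last y p; x] |: path_edges y p).
Proof. by move=> U; rewrite cycle_edges_cons //= path_edges_rcons. Qed.

Lemma is_cycle_rot n c : is_cycle (rot n c) <-> is_cycle c.
Proof. by rewrite /is_cycle size_rot rot_ucycle. Qed.

Lemma is_cycle_uniq c : is_cycle c -> uniq c.
Proof. by case=> _ /andP[]. Qed.

Lemma cycle_edges_rot n c : is_cycle c -> cycle_edges (rot n c) = cycle_edges c.
Proof.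
move=> /is_cycle_uniq Uc; apply/setP=> e; apply/imsetP/imsetP=> -[x xc ->].
  by exists x; rewrite ?next_rot // -(mem_rot n).
by exists x; rewrite ?next_rot ?mem_rot.
Qed.

Lemma is_cycle_split c x : is_cycle c -> x \in c -> exists a q,
  [/\ is_cycle [:: x, a & q], cycle_edges [:: x, a & q] = cycle_edges c
    & [:: x, a & q] =i c].
Proof.
move=> cyc xc; case: (rot_to xc) => n [|a q] def.
  by case: cyc; rewrite -(size_rot n) def.
exists a, q; rewrite -def; split; first exact/is_cycle_rot.
  exact: cycle_edges_rot.
by move=> y; rewrite mem_rot.
Qed.

Lemma cycle_edgeP c e : is_cycle c -> e \in cycle_edges c ->
  exists a b, [/\ e = [set a; b], a \in c, b \in c & a -- b].
Proof.
case=> _ /andP[cyc _] /imsetP[x xc ->].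
by exists x, (next c x); rewrite mem_next xc (next_cycle cyc).
Qed.

Lemma cycle_nbrs c x : is_cycle c -> x \in c -> exists a b,
  [/\ a != b, [/\ a \in c, b \in c, x -- a & x -- b],
      [set x; a] \in cycle_edges c & [set x; b] \in cycle_edges c].
Proof.
move=> cyc xc; have [a [q [cyc' <- eqc]]] := is_cycle_split cyc xc.
have Uc := is_cycle_uniq cyc'; rewrite cycle_edges_cons2 //.
have lq : last a q \in a :: q by rewrite mem_last.
exists a, (last a q); rewrite -!eqc !inE !eqxx /= -in_cons lq !orbT.
rewrite [[set x; last _ _]]setUC eqxx orbT; split=> //.
  case: q cyc' Uc {eqc lq} => [[]|b q _] //=; rewrite !inE => /and3P[_ + _].
  by apply: contraNneq => ->; rewrite -in_cons mem_last.
case: cyc' => _ /andP[]; rewrite /= rcons_path => /andP[-> /andP[_]].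
by rewrite sedge_sym.
Qed.

(** This is where length at least 3 enters: two vertices that succeed each other would yield the
    same edge, and [card_cycle_edges] would fail. *)
Lemma next_inj2 c x : is_cycle c -> x \in c -> next c (next c x) != x.
Proof.
move=> cyc xc; case: (rot_to xc) => n [|a [|b q]] def;
  try by case: cyc; rewrite -(size_rot n) def.
have Uc := is_cycle_uniq cyc; have := Uc; rewrite -(rot_uniq n) def.
rewrite -!(next_rot n Uc) def /= eqxx /=; rewrite !inE !negb_or => /and4P[/and3P[ax bx _] _ _ _].
by rewrite (eq_sym a x) (negPf ax) eqxx eq_sym.
Qed.

Lemma card_cycle_edges c : is_cycle c -> #|cycle_edges c| = #|[set x in c]|.
Proof.
move=> cyc; rewrite card_in_imset ?cardsE // => x y xc yc /setP eqe.
have Uc := is_cycle_uniq cyc.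
have := eqe x; rewrite !inE eqxx /= => /esym/predU1P[//|/eqP ex].
have := eqe y; rewrite !inE eqxx /= => /predU1P[//|/eqP ey].
by have := next_inj2 cyc xc; rewrite -ey -ex eqxx.
Qed.

Lemma card_cycle c : is_cycle c -> #|[set x in c]| = size c.
Proof. by move/is_cycle_uniq/card_uniqP=> <-; rewrite cardsE. Qed.

Lemma sub_cycle_edges c1 c2 : is_cycle c2 ->
  cycle_edges c1 \subset cycle_edges c2 -> [set x in c1] \subset [set x in c2].
Proof.
move=> cyc /subsetP s12; apply/subsetP=> x; rewrite !inE => xc.
have /s12/(cycle_edgeP cyc)[a [b [eqe ac bc _]]] : [set x; next c1 x] \in cycle_edges c1.
  by apply/imsetP; exists x.
by have /setP/(_ x) := eqe; rewrite !inE eqxx => /esym/orP[]/eqP->.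
Qed.

Lemma eq_cycle_edges_supp c1 c2 : is_cycle c1 -> is_cycle c2 ->
  cycle_edges c1 = cycle_edges c2 -> [set x in c1] = [set x in c2].
Proof. by move=> cyc1 cyc2 eqe; apply/eqP; rewrite eqEsubset !sub_cycle_edges ?eqe. Qed.

Lemma triangle_edges c : is_cycle c -> #|[set x in c]| = 3 ->
  cycle_edges c = [set e : {set G} | (e \subset [set x in c]) && (#|e| == 2)].
Proof.
move=> cyc card3; apply/eqP; rewrite eqEcard; apply/andP; split.
  apply/subsetP=> e /(cycle_edgeP cyc)[a [b [-> ac bc ab]]].
  have anb : a != b by apply: contraTneq ab => ->; rewrite sedge_irrefl.
  by rewrite inE cards2 anb andbT; apply/subsetP=> z; rewrite !inE => /orP[]/eqP->.
rewrite card_cycle_edges // card3.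
by rewrite cards_draws card3.
Qed.

Lemma eq_triangle_edges c1 c2 : is_cycle c1 -> is_cycle c2 ->
  #|[set x in c1]| = 3 -> [set x in c1] = [set x in c2] ->
  cycle_edges c1 = cycle_edges c2.
Proof. by move=> cyc1 cyc2 c3 eqs; rewrite !triangle_edges -?eqs. Qed.

End Cycles.

(** Injectivity is asked on [c] only, since a contraction is injective merely on sets that miss an
    end of the contracted edge. *)
Lemma map_cycle_hom (H G : sgraph) (f : H -> G) (c : seq H) :
  {in c &, injective f} -> {in c &, {homo f : x y / x -- y}} ->
  is_cycle c -> is_cycle (map f c).
Proof.
move=> f_inj fh [sz /andP[cyc Uc]]; split; first by rewrite size_map.
rewrite /ucycle map_inj_in_uniq // Uc andbT.
have := @homo_cycle_in _ _ (mem c) f (@sedge H) (@sedge G).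
by apply=> //; apply/allP.
Qed.

Section MapCycle.
Variables (H G : sgraph) (f : H -> G).
Hypothesis f_inj : injective f.

Lemma map_cycle_edges c : is_cycle c ->
  cycle_edges (map f c) = [set f @: (e : {set H}) | e in cycle_edges c].
Proof.
case: c => [[]|x p] // cyc; have Uc := is_cycle_uniq cyc.
rewrite /= !cycle_edges_cons ?path_edges_map -?map_rcons ?path_edges_map //.
by rewrite -map_cons map_inj_uniq.
Qed.

Lemma map_cycleV c : {mono f : x y / x -- y} -> is_cycle (map f c) -> is_cycle c.
Proof.
move=> fm [sz /andP[cyc Uc]]; split; first by rewrite size_map in sz.
rewrite /ucycle -(map_inj_uniq f_inj) Uc andbT.
case: c cyc {sz Uc} => [|x p] //=; rewrite -map_rcons path_map.
by apply: sub_path => u v; rewrite /= fm.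
Qed.

End MapCycle.

(** Membership of [delete X] in the class, stated on [G] itself; once [apexP] is proved, the sigma
    type of [delete X] is no longer met. *)
Definition one_cycle_off (G : sgraph) (X : {set G}) :=
  forall c1 c2 : seq G, is_cycle c1 -> is_cycle c2 ->
  [disjoint c1 & X] -> [disjoint c2 & X] -> cycle_edges c1 = cycle_edges c2.

Lemma apexP k (G : sgraph) :
  apex k sub_unicyclic G <-> exists2 X : {set G}, #|X| <= k & one_cycle_off X.
Proof.
split=> -[X leX uX]; exists X => //; pose f : delete X -> G := val;
  have inj : injective f by apply: val_inj.
  have lift c : is_cycle c -> [disjoint c & X] ->
      exists2 d : seq (delete X), is_cycle d & map f d = c.
    move=> cyc dX; have cX : all (fun x => x \in ~: X) c.
      by apply/allP=> x xc; rewrite inE (disjointFr dX).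
    have [d def] : exists d : seq (delete X), map f d = c.
      elim: c cX {cyc dX} => [|x c IHc] /=; first by exists [::].
      by case/andP=> xX /IHc[d <-]; exists (exist _ x xX :: d).
    by exists d => //; apply: (map_cycleV inj) => //; rewrite def.
  move=> c1 c2 cyc1 cyc2 d1 d2.
  have [e1 cye1 <-] := lift _ cyc1 d1; have [e2 cye2 <-] := lift _ cyc2 d2.
  by rewrite !(map_cycle_edges inj) // (uX e1 e2).
move=> c1 c2 cyc1 cyc2.
have off (c : seq (delete X)) : [disjoint map f c & X].
  rewrite disjoint_has; apply/hasPn=> _ /mapP[[x xX] _ ->] /=.
  by have := xX; rewrite inE.
have cycf (c : seq (delete X)) : is_cycle c -> is_cycle (map f c).
  by apply: map_cycle_hom => // u v _ _; apply: inj.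
apply: (imset_inj (imset_inj inj)); rewrite -[LHS]map_cycle_edges // -[RHS]map_cycle_edges //.
by apply: uX (off _) (off _); apply: cycf.
Qed.

(** * Minors *)

Lemma apex_subgraph k (H G : sgraph) :
  subgraph H G -> apex k sub_unicyclic G -> apex k sub_unicyclic H.
Proof.
move=> [f inj hom] /apexP[X leX uX]; apply/apexP; exists (f @^-1: X).
  rewrite -(card_imset _ inj); apply: leq_trans leX; apply: subset_leq_card.
  by apply/subsetP=> _ /imsetP[x + ->]; rewrite inE.
move=> c1 c2 cyc1 cyc2 d1 d2; apply: (imset_inj (imset_inj inj)).
have off (c : seq H) : [disjoint c & f @^-1: X] -> [disjoint map f c & X].
  rewrite !disjoint_has => /hasPn off; apply/hasPn=> _ /mapP[x xc ->].
  by have := off x xc; rewrite inE.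
rewrite -!map_cycle_edges //; apply: uX; rewrite ?off //;
  by apply: map_cycle_hom => // x y _ _; [apply: inj | apply: hom].
Qed.

(** * Lifting cycles through the contraction of an edge *)

Section Contract.
Variables (G : sgraph) (x y : G).
Hypothesis xy : x -- y.
Let K := contract x y.

Lemma contract_neq : x != y.
Proof. by apply: contraTneq xy => ->; rewrite sedge_irrefl. Qed.

Definition contract_pt : K := exist _ x contract_neq.

(** The default value of [insubd] does the contraction: [y], the only vertex outside the subtype, is
    sent to [contract_pt]. *)
Definition contract_map (z : G) : K := insubd contract_pt z.

Lemma contract_map_val (z : K) : contract_map (val z) = z.
Proof. exact: valKd. Qed.

Lemma contract_mapK (z : G) : z != y -> val (contract_map z) = z.
Proof. by move=> zy; apply: insubdK. Qed.

Lemma contract_map_y : contract_map y = contract_pt.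
Proof. by rewrite /contract_map /insubd insubF // eqxx. Qed.

Lemma contract_map_x : contract_map x = contract_pt.
Proof. by apply: val_inj; rewrite contract_mapK // contract_neq. Qed.

Lemma contract_map_eq (u v : G) : contract_map u = contract_map v ->
  u = v \/ (u \in [set x; y]) && (v \in [set x; y]).
Proof.
have xNy := contract_neq; have [->|uy] := eqVneq u y; last first.
  have [->|vy] := eqVneq v y; last by move/(congr1 val); rewrite !contract_mapK //; left.
  rewrite contract_map_y => /(congr1 val); rewrite contract_mapK // => ->.
  by right; rewrite !inE !eqxx ?orbT.
have [->|vy] := eqVneq v y; first by left.
rewrite contract_map_y => /esym/(congr1 val); rewrite contract_mapK // => ->.
by right; rewrite !inE !eqxx ?orbT.
Qed.

Lemma contract_map_hom (u v : G) : u -- v ->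
  contract_map u != contract_map v -> contract_map u -- contract_map v.
Proof.
move=> uv uNv; rewrite /= /contract_edge uNv /=.
have [uy|uy] := eqVneq u y; have [vy|vy] := eqVneq v y.
- by rewrite uy vy eqxx in uNv.
- by move: uv; rewrite uy contract_map_y (contract_mapK vy) /= eqxx => ->; rewrite orbT.
- by move: uv; rewrite vy sedge_sym contract_map_y (contract_mapK uy) /= eqxx => ->; rewrite !orbT.
by rewrite !contract_mapK // uv.
Qed.

Lemma contract_edge_lift (u v : K) : u -- v ->
  [\/ val u -- val v, u = contract_pt /\ y -- val v | v = contract_pt /\ y -- val u].
Proof.
by move=> /andP[_ /or3P[-> | /andP[/eqP e ->] | /andP[/eqP e ->]]];
  [constructor 1 | constructor 2 | constructor 3]; split=> //; apply: val_inj.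
Qed.

(* The contracted edge, if it is in S, is mapped to the removed singleton. *)
Definition contract_edges (S : {set {set G}}) : {set {set K}} :=
  [set contract_map @: (e : {set G}) | e in S] :\ [set contract_pt].

Lemma path_edges_contract (u : G) p :
  [set contract_map @: (e : {set G}) | e in path_edges u p] =
  path_edges (contract_map u) (map contract_map p).
Proof. by rewrite path_edges_map. Qed.

(** Away from [contract_pt] the edges of [c] are edges of [G], and the two neighbours of
    [contract_pt] on [c] are adjacent in [G] to [x] or to [y]. If one end serves both neighbours, it
    replaces [contract_pt]; otherwise the edge [x -- y] is inserted, whose image is the singleton
    that [contract_edges] removes. *)
Lemma contract_cycle_lift (c : seq K) : is_cycle c -> exists d : seq G,
  [/\ is_cycle d, contract_edges (cycle_edges d) = cycle_edges c
    & contract_map @: [set z in d] = [set z in c]].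
Proof.
move=> cyc.
have mapK (s : seq K) : map contract_map (map val s) = s.
  by rewrite -map_comp map_id_in // => z _ /=; apply: contract_map_val.
have edgeN : [set contract_pt] \notin cycle_edges c.
  apply/negP=> /(cycle_edgeP cyc)[a [b [/setP ab ac bc]]].
  have eqpt z : z \in [set a; b] -> z = contract_pt by rewrite -ab inE => /eqP.
  move: bc; rewrite (eqpt a (set21 a b)) (eqpt b (set22 a b)).
  by rewrite (@sedge_irrefl K).
have lift_path (a : K) (p : seq K) : contract_pt \notin a :: p -> path (@sedge K) a p ->
    path (@sedge G) (val a) (map val p).
  rewrite path_map; elim: p a => [|b p IHp] a //= aNp /andP[ab pb].
  rewrite IHp ?andbT //; last by move: aNp; rewrite inE negb_or => /andP[].
  move: aNp; rewrite !inE !negb_or => /and3P[aN bN _].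
  by case: (contract_edge_lift ab) => // -[e _]; [move: aN | move: bN]; rewrite e eqxx.
have [xc|xNc] := boolP (contract_pt \in c); last first.
  exists (map val c); split.
  - split; first by rewrite size_map; case: cyc.
    rewrite /ucycle (map_inj_uniq val_inj) (is_cycle_uniq cyc) andbT.
    case: c cyc {edgeN} xNc => [|a p] //= [_ /andP[cyc _]] xNc.
    rewrite -map_rcons; apply: lift_path; last exact: cyc.
    by rewrite inE mem_rcons inE orbA orbb -in_cons.
  - case: c cyc xNc edgeN => [|a p] cyc xNc edgeN; first by case: cyc.
    have Up := is_cycle_uniq cyc.
    rewrite [LHS]/contract_edges /= !cycle_edges_cons //; last first.
      by rewrite -map_cons (map_inj_uniq val_inj).
    rewrite path_edges_contract -map_rcons mapK contract_map_val.
    by apply/setDidPl; rewrite disjoint_sym disjoints1 -cycle_edges_cons.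
  apply/setP=> z; rewrite inE; apply/imsetP/idP => [[w]|zc].
    by rewrite inE => /mapP[u uc ->] ->; rewrite contract_map_val.
  by exists (val z); rewrite ?contract_map_val // inE map_f.
have [a [q [cyc' eqe eqc]]] := is_cycle_split cyc xc.
have Uc := is_cycle_uniq cyc'; have := Uc; rewrite cons_uniq => /andP[xNq Uq].
have [xa [pq qx]] : contract_pt -- a /\ path (@sedge K) a q /\ last a q -- contract_pt.
  by have [_ /andP[]] := cyc'; rewrite /= rcons_path => /and3P[].
have pq' := lift_path _ _ xNq pq.
have lNa : 0 < size q by case: (q) cyc' => [[]|].
set l := last a q in qx; have vl : val l = last (val a) (map val q) by rewrite last_map.
have valq : uniq (val a :: map val q) by rewrite -map_cons (map_inj_uniq val_inj).
have yNq : y \notin val a :: map val q.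
  by rewrite -map_cons; apply/mapP=> -[u _ e]; have := valP u; rewrite /= -e eqxx.
have xNq' : x \notin val a :: map val q.
  by rewrite -map_cons; apply: contra xNq => /mapP[u uq e]; rewrite (_ : contract_pt = u) //; apply: val_inj.
have xNy := contract_neq.
(* One end [z] of the contracted edge is adjacent to both neighbours: the lift has the length of
   [c]. *)
have edges1 z : contract_map z = contract_pt -> z \notin val a :: map val q ->
    z -- val a -> val l -- z -> exists d : seq G,
  [/\ is_cycle d, contract_edges (cycle_edges d) = cycle_edges c
    & contract_map @: [set z in d] = [set z in c]].
  move=> mz zN za lz; exists [:: z, val a & map val q].
  have cycd : is_cycle [:: z, val a & map val q].
    split; first by rewrite /= size_map.
    by rewrite /ucycle cons_uniq zN valq /= rcons_path za pq' -vl lz.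
  split=> //.
    rewrite /contract_edges cycle_edges_cons2; last exact: is_cycle_uniq cycd.
    rewrite !imsetU !imset_set1 !imsetU1 !imset_set1 path_edges_contract mapK mz.
    rewrite -vl !contract_map_val -cycle_edges_cons2 // eqe.
    by apply/setDidPl; rewrite disjoint_sym disjoints1.
  apply/setP=> w; rewrite inE -eqc; apply/imsetP/idP => [[u]|wc].
    rewrite inE in_cons -map_cons => /predU1P[->|/mapP[v vq ->] ->].
      by rewrite mz => ->; rewrite !inE eqxx.
    by rewrite contract_map_val in_cons vq orbT.
  move: wc; rewrite in_cons => /predU1P[->|wq].
    by exists z => //; rewrite inE mem_head.
  by exists (val w); rewrite ?contract_map_val // inE in_cons -map_cons map_f ?orbT.
(* The neighbours hang on different ends: the lift runs through the edge between [z1] and [z2] and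
   is longer by one. *)
have edges2 z1 z2 : contract_map z1 = contract_pt -> contract_map z2 = contract_pt ->
    z1 \notin val a :: map val q -> z2 \notin val a :: map val q -> z1 != z2 ->
    z1 -- z2 -> z2 -- val a -> val l -- z1 -> exists d : seq G,
  [/\ is_cycle d, contract_edges (cycle_edges d) = cycle_edges c
    & contract_map @: [set z in d] = [set z in c]].
  move=> mz1 mz2 z1N z2N z12 zz za lz; exists [:: z1, z2, val a & map val q].
  have cycd : is_cycle [:: z1, z2, val a & map val q].
    split; first by rewrite /= size_map.
    rewrite /ucycle cons_uniq in_cons negb_or z12 z1N cons_uniq z2N valq.
    by rewrite /= rcons_path zz za pq' -vl lz.
  split=> //.
    rewrite /contract_edges cycle_edges_cons2; last exact: is_cycle_uniq cycd.
    rewrite [path_edges z2 _]/= !imsetU !imset_set1 !imsetU1 !imset_set1 path_edges_contract mapK mz1 mz2.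
    rewrite -/(last (val a) (map val q)) /= -vl !contract_map_val setUid.
    rewrite (setUCA _ [set [set contract_pt; a]]) -cycle_edges_cons2 // eqe.
    by rewrite setU1K.
  apply/setP=> w; rewrite inE -eqc; apply/imsetP/idP => [[u]|wc].
    rewrite inE !in_cons -in_cons -map_cons => /or3P[/eqP->|/eqP->|/mapP[v vq ->] ->].
    - by rewrite mz1 => ->; rewrite eqxx.
    - by rewrite mz2 => ->; rewrite eqxx.
    by rewrite contract_map_val -in_cons vq orbT.
  move: wc => /predU1P[->|wq].
    by exists z1 => //; rewrite inE mem_head.
  by exists (val w); rewrite ?contract_map_val // inE !in_cons -in_cons -map_cons map_f ?orbT.
have aN : a != contract_pt by apply: contraNneq xNq => <-; rewrite mem_head.
have lN : l != contract_pt by apply: contraNneq xNq => <-; rewrite mem_last.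
have xa' : x -- val a \/ y -- val a.
  case: (contract_edge_lift xa) => [|[_ ?]|[e _]]; [by left | by right |].
  by rewrite e eqxx in aN.
have lx' : val l -- x \/ val l -- y.
  case: (contract_edge_lift qx) => [|[e _]|[_ ?]]; [by left | | by right; rewrite sedge_sym].
  by rewrite e eqxx in lN.
have yx : y -- x by rewrite sedge_sym.
case: xa' => xa'; case: lx' => lx'.
- exact: (edges1 x contract_map_x).
- by apply: (edges2 y x contract_map_y contract_map_x) => //; rewrite eq_sym.
- exact: (edges2 x y contract_map_x contract_map_y).
exact: (edges1 y contract_map_y).
Qed.

End Contract.

(** Cycles that avoid the image of [X] lift to cycles that avoid [X]. These have a common edge set,
    and [contract_edges] recovers from it the edge set of either original cycle. *)
Lemma apex_contract k (G : sgraph) (x y : G) : x -- y ->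
  apex k sub_unicyclic G -> apex k sub_unicyclic (contract x y).
Proof.
move=> xy /apexP[X leX uX]; apply/apexP; exists (contract_map xy @: X).
  exact: leq_trans (leq_imset_card _ _) leX.
move=> c1 c2 cyc1 cyc2 d1 d2.
have [e1 [cye1 <- s1]] := contract_cycle_lift xy cyc1.
have [e2 [cye2 <- s2]] := contract_cycle_lift xy cyc2.
have off (c : seq (contract x y)) (e : seq G) : contract_map xy @: [set z in e] = [set z in c] ->
    [disjoint c & contract_map xy @: X] -> [disjoint e & X].
  move=> se; rewrite !disjoint_has => /hasPn off; apply/hasPn=> z ze.
  have /off : contract_map xy z \in c.
    by have /setP/(_ (contract_map xy z)) := se; rewrite [in RHS]inE => <-; rewrite imset_f ?inE.
  by apply: contra => zX; apply: imset_f.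
by rewrite (uX e1 e2) ?(off _ _ s1) ?(off _ _ s2).
Qed.

Lemma apex_contracts_to k (H G : sgraph) :
  contracts_to G H -> apex k sub_unicyclic G -> apex k sub_unicyclic H.
Proof.
elim=> [{}G {}H [f [g fK gK] fe] | {}G {}H x y xy _ IH uG].
  apply: apex_subgraph; exists g; first exact: can_inj gK.
  by move=> u v uv; rewrite -fe !gK.
exact/IH/apex_contract.
Qed.

(** * Deleting an edge, and testing minimality one edge at a time *)

Section DeleteEdge.
Variables (G : sgraph) (e : {set G}).

(** Only the relation changes and the vertex type stays, so that sequences and vertex sets can be
    read in both graphs without transport. *)
Definition deleted_edge : rel G := fun u v => (u -- v) && ([set u; v] != e).

Lemma deleted_edge_sym : symmetric deleted_edge.
Proof. by move=> u v; rewrite /deleted_edge sedge_sym setUC. Qed.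

Lemma deleted_edge_irrefl : irreflexive deleted_edge.
Proof. by move=> u; rewrite /deleted_edge sedge_irrefl. Qed.

Definition delete_edge : sgraph := SGraph deleted_edge_sym deleted_edge_irrefl.

Lemma delete_edge_cycle (c : seq G) : is_cycle (G := G) c ->
  e \notin cycle_edges (G := G) c -> is_cycle (G := delete_edge) c.
Proof.
move=> cyc eNc; have Uc := is_cycle_uniq cyc.
case: (cyc) => sz /andP[cy _]; split=> //; rewrite /ucycle Uc andbT.
apply: cycle_from_next => // z zc; rewrite /= /deleted_edge (next_cycle cy) //=.
by apply: contraNneq eNc => <-; apply/imsetP; exists z.
Qed.

Lemma cycle_of_delete_edge (c : seq G) : is_cycle (G := delete_edge) c ->
  is_cycle (G := G) c /\ e \notin cycle_edges (G := G) c.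
Proof.
move=> cyc; have [sz /andP[cy Uc]] := cyc; split.
  by split=> //; rewrite /ucycle Uc andbT; apply: sub_cycle cy => u v /andP[].
apply/negP=> /(@cycle_edgeP delete_edge _ _ cyc)[a [b [eqe _ _ /andP[_]]]].
by rewrite eqe eqxx.
Qed.

End DeleteEdge.

Lemma card_graph_iso (H G : sgraph) : graph_iso H G -> #|H| = #|G|.
Proof. by case=> f /bij_eq_card. Qed.

(** The point is properness: an isomorphism would map the ordered adjacent pairs of [G] injectively
    into those that remain, which are fewer. *)
Lemma obs_delete_edge (C : graph_class) (G : sgraph) (x y : G) :
  obs C G -> x -- y -> C (delete_edge [set x; y]).
Proof.
move=> [_ minG] xy; apply: minG; split.
  exists (delete_edge [set x; y]).
    by exists id => // u v /andP[].
  by constructor; exists id => //; exists id.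
case=> f bf fe; have [g fK gK] := bf.
pose A := [set p : G * G | p.1 -- p.2].
pose B := [set p : G * G | (p.1 -- p.2) && ([set p.1; p.2] != [set x; y])].
have AB : #|A| <= #|B|.
  pose h (p : G * G) := (g p.1, g p.2).
  have inj_h : injective h.
    by case=> u1 v1 [u2 v2] [/(can_inj gK)-> /(can_inj gK)->].
  rewrite -(card_imset _ inj_h); apply: subset_leq_card.
  apply/subsetP=> _ /imsetP[[u v] + ->]; rewrite !inE /= => uv.
  by have := fe (g u) (g v); rewrite !gK uv => /esym.
have : B \proper A.
  apply/properP; split; first by apply/subsetP=> p; rewrite !inE => /andP[].
  by exists (x, y); rewrite !inE /= xy // eqxx.
by move/proper_card; rewrite ltnNge AB.
Qed.

Lemma obs_contract (C : graph_class) (G : sgraph) (x y : G) :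
  obs C G -> x -- y -> C (contract x y).
Proof.
move=> [_ minG] xy; apply: minG; split.
  exists G; first by exists id.
  apply: (contracts_step xy); constructor; exists id => //; by exists id.
move/card_graph_iso; have -> : #|contract x y| = #|predC1 y|.
  by rewrite card_sig; apply: eq_card.
have := cardC1 y; have : 0 < #|G| by apply/card_gt0P; exists x.
by lia.
Qed.

Lemma contracts_to_inv (G H : sgraph) : contracts_to G H ->
  graph_iso G H \/ exists x y : G, x -- y /\ contracts_to (contract x y) H.
Proof.
by case=> [{}G {}H|{}G {}H x y xy conH]; [left | right; exists x, y].
Qed.

(** Let [f] embed the subgraph [G'] that is contracted to [H]. If [f] misses an edge of [G], then
    [G'] embeds in the graph without that edge. If not, [f] is onto, since a missed vertex would
    leave an edge at it uncovered (hence the ban on isolated vertices), and [f] is an isomorphism;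
    then a contraction must take place. *)
Lemma obs_apexI k (G : sgraph) :
  ~ apex k sub_unicyclic G -> (forall x : G, exists y, x -- y) ->
  (forall x y : G, x -- y -> apex k sub_unicyclic (delete_edge [set x; y])) ->
  (forall x y : G, x -- y -> apex k sub_unicyclic (contract x y)) ->
  obs (apex k sub_unicyclic) G.
Proof.
move=> nG nbr delG conG; split=> // H [[G' [f inj hom] conGH] niso].
have [[[z w] /= zw sub]|full] := classic (exists2 p : G * G, p.1 -- p.2 &
    forall u v, u -- v -> [set f u; f v] != [set p.1; p.2]).
  apply: apex_contracts_to conGH _; apply: apex_subgraph _ (delG z w zw).
  by exists f => // u v uv; rewrite /= /deleted_edge hom ?sub.
have surj z : exists u, f u = z.
  apply: NNPP => nz; have [w zw] := nbr z; apply: full; exists (z, w) => // u v uv.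
  apply/eqP=> /setP/(_ z); rewrite !inE eqxx /= => /orP[]/eqP e; apply: nz;
    by [exists u | exists v].
have mono u v : (f u -- f v) = (u -- v).
  apply/idP/idP=> [fuv|/hom//]; apply: contraT => nuv; case: full.
  exists (f u, f v) => // a b ab; apply: contraNneq nuv => /=.
  have -> : [set f a; f b] = f @: [set a; b] by rewrite imsetU1 imset_set1.
  have -> : [set f u; f v] = f @: [set u; v] by rewrite imsetU1 imset_set1.
  move=> /(imset_inj inj)/setP eqs; have uNv : u != v.
    by apply: contraTneq fuv => ->; rewrite sedge_irrefl.
  have := eqs u; have := eqs v; rewrite !inE !eqxx orbT /=.
  move=> /orP[]/eqP ev /orP[]/eqP eu; rewrite eu ev ?eqxx // in uNv *.
  by rewrite sedge_sym.
have [g fK] := fin_all_exists surj.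
have isoG : graph_iso G' G by exists f => //; exists g => // u; apply: inj.
(* As [H] is not isomorphic to [G], some edge of [G'] is contracted first, and the result embeds in
   the corresponding contraction of [G]. *)
have [isoH | [x [y [xy conH]]]] := contracts_to_inv conGH.
  case: niso; have [h [h' hK hK'] hm] := isoH; have [f' [f'' fK1 fK2] fm] := isoG.
  exists (f' \o h'); first by exists (h \o f'') => u /=; rewrite ?fK1 ?hK' ?hK ?fK2.
  by move=> u v /=; rewrite fm -hm !hK'.
apply: apex_contracts_to conH _.
have fxy : f x -- f y by apply: hom.
apply: apex_subgraph _ (conG _ _ fxy).
exists (fun z => contract_map fxy (f (val z))).
  move=> u v /contract_map_eq[/inj/val_inj//|].
  have inj2 (z : contract x y) : (f (val z) \in [set f x; f y]) -> val z = x :> G'.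
    by rewrite !inE !(inj_eq inj) (negPf (valP z)) orbF => /eqP.
  by case/andP=> /inj2 eu /inj2 ev; apply: val_inj; rewrite eu ev.
move=> u v uv; have uNv : u != v by case/andP: uv.
have fN (z : contract x y) : f (val z) != f y by rewrite (inj_eq inj) (valP z).
apply/andP; split.
  by apply: contra uNv => /eqP/(congr1 val); rewrite !contract_mapK // => /inj/val_inj->.
rewrite !contract_mapK // !(inj_eq inj) !mono.
by case/andP: uv.
Qed.

(** * Families of cycles as hyperforests *)

Lemma path_edges_catl (T : finType) (x : T) p q :
  path_edges x p \subset path_edges x (p ++ q).
Proof.
elim: p x => [|y p IHp] x /=; first exact: sub0set.
exact/setUS/IHp.
Qed.

Section Forest.
Variable G : sgraph.
Implicit Types (S : {set {set G}}) (W : {set G}).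

(** Induction on [W] by removing a vertex with at most one edge in [S]. Without such a vertex, paths
    in [S] could be prolonged beyond [#|G|] vertices, as any attempt to come back closes a cycle. *)
Lemma forest_card S W : W != set0 ->
  (forall e, e \in S -> exists a b, [/\ e = [set a; b], a -- b, a \in W & b \in W]) ->
  (forall c : seq G, is_cycle c -> ~~ (cycle_edges c \subset S)) -> #|S| < #|W|.
Proof.
have [n] := ubnP #|W|; elim: n W S => // n IH W S ltWn Wn0 SW noc.
have [w [wW degw]] : exists w, w \in W /\ #|[set e in S | w \in e]| <= 1.
  apply: NNPP => no_w.
  have deg2 x : x \in W -> forall a, exists b, [/\ b != a, [set x; b] \in S & b \in W].
    move=> xW a; have : ~~ ([set e in S | x \in e] \subset [set [set x; a]]).
      apply/negP=> /subset_leq_card; rewrite cards1 => le1.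
      by apply: no_w; exists x.
    case/subsetPn=> e; rewrite !inE => /andP[eS xe] eN.
    have [u [v [eqe uv uW vW]]] := SW e eS.
    move: xe eN; rewrite eqe !inE => /orP[]/eqP-> eN.
      by exists v; rewrite -eqe; split=> //; apply: contraNneq eN => ->.
    by exists u; rewrite setUC -eqe; split=> //; apply: contraNneq eN => ->; rewrite setUC.
  have adj a b : [set a; b] \in S -> a -- b.
    move=> abS; have [u [v [/setP eqe uv _ _]]] := SW _ abS.
    have := eqe u; have := eqe v; rewrite !inE !eqxx orbT /=.
    have uNv : u != v by apply: contraTneq uv => ->; rewrite sedge_irrefl.
    by case/orP=> /eqP ev /orP[]/eqP eu; subst; rewrite ?eqxx // sedge_sym in uNv uv *.
  have long m : exists x p, [/\ x \in W, size p = m, uniq (x :: p) & path_edges x p \subset S].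
    elim: m => [|m [x [p [xW szp Up pS]]]].
      by have [x xW] := set0Pn _ Wn0; exists x, [::]; rewrite sub0set.
    (* The path grows at its front. Avoiding the second vertex [head x p] ensures that, if [b] is
       already on the path, the cycle closed by [b] has length at least 3. For empty [p] the default
       [x] is harmless. *)
    have [b [bN bS bW]] := deg2 x xW (head x p).
    have xb := adj _ _ bS.
    have [bp|bNp] := boolP (b \in x :: p); last first.
      exists b, (x :: p); split=> //; first by rewrite /= szp.
        by rewrite cons_uniq bNp.
      by rewrite /= subUset sub1set setUC bS.
    have bNx : b != x by apply: contraTneq xb => ->; rewrite sedge_irrefl.
    have bp' : b \in p by rewrite inE (negPf bNx) in bp.
    case/splitPr: p / bp' szp Up pS bN {bp} => p1 p2 szp Up pS bN.
    case: p1 szp Up pS bN => [|a p1] szp Up pS bN; first by rewrite eqxx in bN.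
    have Ud : uniq [:: x, a & rcons p1 b].
      move: Up; rewrite -cat_rcons -cat_cons cat_uniq.
      by case/andP.
    have pathS y q : path_edges y q \subset S -> path (@sedge G) y q.
      elim: q y => //= z q IHq y; rewrite subUset sub1set => /andP[/adj-> /IHq->] //.
    have dS : path_edges x (a :: rcons p1 b) \subset S.
      by apply: subset_trans pS; rewrite -cat_rcons -rcons_cons path_edges_catl.
    have cS : cycle_edges (x :: (a :: rcons p1 b)) \subset S.
      rewrite cycle_edges_cons // path_edges_rcons subUset sub1set -rcons_cons last_rcons setUC bS.
      by rewrite rcons_cons.
    have /noc/negP[] // : is_cycle (x :: (a :: rcons p1 b)).
    split; first by rewrite /= size_rcons.
    rewrite /ucycle Ud andbT [cycle _ _]/= rcons_path last_rcons.
    by have /= /andP[-> ->] := pathS _ _ dS; rewrite sedge_sym xb.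
  have [x [p [_ szp Up _]]] := long #|G|.
  by have := max_card (mem (x :: p)); rewrite (card_uniqP Up) /= szp ltnn.
have [W1|W1n0] := eqVneq (W :\ w) set0.
  have Ww : W = [set w].
    by apply/eqP; rewrite eqEsubset -setD_eq0 W1 eqxx sub1set.
  suff -> : S = set0 by rewrite cards0 card_gt0.
  apply/eqP/set0Pn=> -[e /SW[a [b [_ ab]]]]; rewrite Ww !inE => /eqP ea /eqP eb.
  by rewrite ea eb sedge_irrefl in ab.
have ltS : #|S :\: [set e in S | w \in e]| < #|W :\ w|.
  apply: IH => //; first by have := cardsD1 w W; rewrite wW; lia.
    move=> e; rewrite !inE => /andP[+ eS]; rewrite eS /=.
    have [a [b [-> ab aW bW]]] := SW e eS; rewrite !inE negb_or => /andP[wa wb].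
    by exists a, b; rewrite !inE aW bW eq_sym wa eq_sym wb.
  move=> c /noc; apply: contra => /subset_trans; apply; exact: subsetDl.
have := cardsID [set e in S | w \in e] S; rewrite (setIidPr _); last first.
  by apply/subsetP=> e; rewrite inE => /andP[].
have := cardsD1 w W; rewrite wW; move: ltS degw; lia.
Qed.

End Forest.

Definition is_support (G : sgraph) (T : {set G}) : Prop :=
  exists2 c : seq G, is_cycle c & [set x in c] = T.

Lemma shared_edge (G : sgraph) (c1 c2 : seq G) e : is_cycle c1 -> is_cycle c2 ->
  e \in cycle_edges c1 -> e \in cycle_edges c2 ->
  1 < #|[set x in c1] :&: [set x in c2]|.
Proof.
move=> cyc1 cyc2 e1 e2; have [a [b [eqe a1 b1 ab]]] := cycle_edgeP cyc1 e1.
have [a' [b' [eqe' a2 b2 _]]] := cycle_edgeP cyc2 e2.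
have aNb : a != b by apply: contraTneq ab => ->; rewrite sedge_irrefl.
have <- : #|[set a; b]| = 2 by rewrite cards2 aNb.
apply: subset_leq_card; rewrite subsetI; apply/andP; split.
  by apply/subsetP=> z; rewrite !inE => /orP[]/eqP->.
by rewrite -eqe eqe'; apply/subsetP=> z; rewrite !inE => /orP[]/eqP->.
Qed.

Section Hyperforest.
Variables (V I : finType).
Implicit Types (D : I -> {set V}) (J : {set I}).

(* That is, sum (#|D j| - 1) < #|union|: this holds for all subfamilies exactly
   when the incidence graph of the family is a forest. *)
Definition hyperforest D J0 := forall J, J \subset J0 -> J != set0 ->
  (\sum_(j in J) #|D j|).+1 <= #|\bigcup_(j in J) D j| + #|J|.

Lemma double_count D J (W : {set V}) : \bigcup_(j in J) D j \subset W ->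
  \sum_(j in J) #|D j| = \sum_(x in W) #|[set j in J | x \in D j]|.
Proof.
move=> sW; under eq_bigr do rewrite -sum1_card.
under [RHS]eq_bigr do rewrite -sum1_card.
rewrite (exchange_big_dep (mem W)) /=.
  by apply: eq_bigr => x xW; apply: eq_bigl => j; rewrite inE.
by move=> j x jJ xj; apply: (subsetP sW); apply/bigcupP; exists j.
Qed.

End Hyperforest.

(** An edge [r j] is removed from each chosen cycle [c j]; different members share no edge, so the
    rest [S] has sum (|D j| - 1) edges. A cycle inside [S] shares an edge, hence two vertices, with
    some [c j] and so has all its edges, including [r j]; but [r j] was removed from [c j] and lies
    on no other member. *)
Lemma cycles_hyperforest (G : sgraph) (I : finType) (D : I -> {set G}) (J0 : {set I}) :
  (forall j, j \in J0 -> is_support (D j)) ->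
  {in J0 &, forall i j, i != j -> #|D i :&: D j| <= 1} ->
  (forall c1 c2 : seq G, is_cycle c1 -> is_cycle c2 ->
     1 < #|[set x in c1] :&: [set x in c2]| -> cycle_edges c1 = cycle_edges c2) ->
  hyperforest D J0.
Proof.
move=> cycD disD Q J sJ Jn0.
have [c cP] : exists c : I -> seq G,
    forall j, j \in J -> is_cycle (c j) /\ [set x in c j] = D j.
  apply: (@fin_all_exists _ _ (fun j c => j \in J -> is_cycle c /\ [set x in c] = D j)) => j.
  have [/(subsetP sJ)/cycD[c cyc eqc]|_] := boolP (j \in J); first by exists c.
  by exists [::].
have cardE j : j \in J -> #|cycle_edges (c j)| = #|D j|.
  by move=> /cP[cyc <-]; apply: card_cycle_edges.
have ne j : j \in J -> exists e, e \in cycle_edges (c j).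
  move=> jJ; apply/set0Pn; rewrite -card_gt0 cardE //.
  by have [cyc <-] := cP j jJ; rewrite card_cycle //; case: cyc => /ltnW/ltnW.
have [r rP] : exists r : I -> {set G}, forall j, j \in J -> r j \in cycle_edges (c j).
  apply: (@fin_all_exists _ _ (fun j e => j \in J -> e \in cycle_edges (c j))) => j.
  have [/ne[e ej]|_] := boolP (j \in J); first by exists e.
  by exists set0.
have uniqE i j e : i \in J -> j \in J -> e \in cycle_edges (c i) ->
    e \in cycle_edges (c j) -> i = j.
  move=> iJ jJ ei ej; apply/eqP/negPn/negP=> iNj.
  have := disD i j (subsetP sJ i iJ) (subsetP sJ j jJ) iNj; apply/negP; rewrite -ltnNge.
  have [cyi <-] := cP i iJ; have [cyj <-] := cP j jJ; exact: shared_edge ei ej.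
pose S := \bigcup_(j in J) (cycle_edges (c j) :\ r j).
pose W := \bigcup_(j in J) D j.
have cardS : \sum_(j in J) #|D j| <= #|S| + #|J|.
  have -> : \sum_(j in J) #|D j| = \sum_(j in J) (#|cycle_edges (c j) :\ r j| + 1).
    by apply: eq_bigr => j jJ; rewrite -cardE // (cardsD1 (r j)) rP // addnC.
  rewrite big_split /= sum1_card leq_add2r (double_count (subxx S)) -sum1_card.
  apply: leq_sum => e _; apply/card_le1_eqP=> i j; rewrite !inE.
  by move=> /andP[iJ /andP[_ ei]] /andP[jJ /andP[_ ej]]; apply: (uniqE _ _ e).
suff : #|S| < #|W| by move: cardS; rewrite -/W; lia.
apply: forest_card.
- have [j jJ] := set0Pn _ Jn0; have [e] := ne j jJ.
  have [cyc eqc] := cP j jJ.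
  case/(cycle_edgeP cyc)=> a [_ [_ ac _ _]]; apply/set0Pn; exists a.
  by apply/bigcupP; exists j => //; rewrite -eqc inE.
- move=> e /bigcupP[j jJ]; rewrite inE => /andP[_ ej].
  have [cyc eqc] := cP j jJ; have [a [b [-> ac bc ab]]] := cycle_edgeP cyc ej.
  by exists a, b; split=> //; apply/bigcupP; exists j; rewrite // -eqc inE.
move=> d cyd; apply/negP=> dS.
have [e ed] : exists e, e \in cycle_edges d.
  apply/set0Pn; rewrite -card_gt0 card_cycle_edges // card_cycle //.
  by case: cyd => /ltnW/ltnW.
have /bigcupP[j jJ] := subsetP dS e ed; rewrite inE => /andP[eNr ej].
have [cyc eqc] := cP j jJ.
have eqE : cycle_edges d = cycle_edges (c j).
  by apply: Q => //; apply: shared_edge ed ej.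
have /(subsetP dS)/bigcupP[i iJ] : r j \in cycle_edges d by rewrite eqE rP.
rewrite !inE => /andP[rN ri]; move: rN.
by rewrite (uniqE i j (r j) iJ jJ ri (rP j jJ)) eqxx.
Qed.

Section HyperforestTheory.
Variable V : finType.
Implicit Types (F : {set {set V}}) (T : {set V}).

(** Let [d x] be the number of members through [x]. Without a leaf every member has two vertices
    with [d x > 1], so that the sum of [d] over such vertices is at least 2|F|. Together with [le3]
    this gives |W| + |F| <= sum of [d], against the inequality for [F]. *)
Lemma hyperforest_leaf F : F != set0 -> (forall T, T \in F -> T != set0) ->
  hyperforest id F ->
  exists2 T, T \in F & exists2 v, v \in T & forall D, D \in F -> D :&: T != set0 -> v \in D.
Proof.
move=> Fn0 Tn0 hypF; apply: NNPP => noleaf.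
pose d x := #|[set T in F | x \in T]|; pose W := \bigcup_(T in F) T.
have sumd := double_count (subxx W); rewrite -/W in sumd.
have dpos x : x \in W -> 0 < d x.
  by case/bigcupP=> T TF xT; apply/card_gt0P; exists T; rewrite inE TF.
have two T : T \in F -> 1 < #|[set x in T | 1 < d x]|.
  move=> TF; have other v : v \in T -> exists w, [/\ w \in T, w != v & 1 < d w].
    move=> vT; apply: NNPP => no; apply: noleaf; exists T => //; exists v => // D DF.
    case/set0Pn=> w /setIP[wD wT]; apply: contraT => vND; case: no; exists w.
    split=> //; first by apply: contraNneq vND => <-.
    rewrite /d (cardsD1 T) (cardsD1 D) !inE TF wT DF wD.
    by have -> : D != T by apply: contraNneq vND => ->.
  have [v vT] := set0Pn _ (Tn0 T TF); have [w [wT _ dw]] := other v vT.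
  have [u [uT uw du]] := other w wT; rewrite (cardsD1 w) (cardsD1 u) !inE.
  by rewrite wT dw uT du uw.
have := hypF F (subxx F) Fn0; rewrite -/W sumd => le1.
have le2 : 2 * #|F| <= \sum_(x in W) (1 < d x) * d x.
  rewrite [leqLHS]mulnC -sum_nat_const.
  apply: (@leq_trans (\sum_(T in F) #|[set x in T | 1 < d x]|)); first exact: leq_sum.
  rewrite (@double_count _ _ (fun T => [set x in T | 1 < d x]) F W); last first.
    by apply/bigcupsP=> T TF; apply: subset_trans (bigcup_sup T TF); apply/subsetP=> x; rewrite inE => /andP[].
  apply: leq_sum => x xW; case: ltnP => dx; rewrite ?mul1n ?mul0n.
    by apply: subset_leq_card; apply/subsetP=> T; rewrite !inE => /and3P[-> ->].
  by rewrite leqn0 cards_eq0; apply/eqP/setP=> T; rewrite !inE ltnNge dx !andbF.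
(* Pointwise, for [d >= 1]: if [d = 1] this is 0 + 2 <= 2, and if [d >= 2] it is d + 2 <= 2d. *)
have le3 : \sum_(x in W) (1 < d x) * d x + 2 * #|W| <= 2 * \sum_(x in W) d x.
  rewrite -sum1_card !big_distrr -big_split /=; apply: leq_sum => x /dpos.
  by case: ltnP; lia.
have {}le1 : (\sum_(x in W) d x).+1 <= #|W| + #|F| by [].
by move: le1 le2 le3; lia.
Qed.

Lemma hyperforest_sub (I : finType) (D : I -> {set V}) (J J' : {set I}) :
  J' \subset J -> hyperforest D J -> hyperforest D J'.
Proof. by move=> sJ hyp K sK; apply: hyp; apply: subset_trans sJ. Qed.

(** Greedy choice at a leaf: [T] joins the packing, [v] joins the hitting set, and all members
    through [v] are dropped. Those left over are disjoint from [T], because every member that meets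
    [T] contains [v]. *)
Lemma hyperforest_hitting_packing F : (forall T, T \in F -> T != set0) -> hyperforest id F ->
  exists A : {set V}, exists2 P : {set {set V}}, [/\ P \subset F, trivIset P & #|A| <= #|P|]
    & forall T, T \in F -> T :&: A != set0.
Proof.
have [n] := ubnP #|F|; elim: n F => // n IH F ltFn Tn0 hyp.
have [->|Fn0] := eqVneq F set0.
  exists set0, set0; first by rewrite sub0set cards0 /trivIset /cover !big_set0 cards0.
  by move=> T; rewrite inE.
have [T TF [v vT leaf]] := hyperforest_leaf Fn0 Tn0 hyp.
pose F' := [set D in F | v \notin D].
have sF : F' \subset F by apply/subsetP=> D; rewrite inE => /andP[].
have [||A [P [sP trivP leA] hitA]] := IH F' _ _ (hyperforest_sub sF hyp).
- rewrite -ltnS; apply: leq_trans ltFn; rewrite ltnS; apply: proper_card; rewrite properE sF; apply/subsetPn.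
  by exists T; rewrite // inE vT andbF.
- by move=> D /(subsetP sF)/Tn0.
have TNP : T \notin P by apply/negP=> /(subsetP sP); rewrite inE vT andbF.
exists (v |: A), (T |: P).
  split.
  - by rewrite subUset sub1set TF (subset_trans sP sF).
  - apply/trivIsetP=> B C; rewrite !inE => /predU1P[->|BP] /predU1P[->|CP] BC.
    + by rewrite eqxx in BC.
    + have /(subsetP sP) := CP; rewrite inE => /andP[CF vC].
      by rewrite disjoint_sym -setI_eq0; apply: contraT => /(leaf _ CF)/idPn; rewrite vC.
    + have /(subsetP sP) := BP; rewrite inE => /andP[BF vB].
      by rewrite -setI_eq0; apply: contraT => /(leaf _ BF)/idPn; rewrite vB.
    by have /trivIsetP := trivP; apply.
  by rewrite !cardsU1 TNP; case: (v \notin A); lia.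
move=> D DF; apply/set0Pn; have [vD|vND] := boolP (v \in D).
  by exists v; rewrite !inE vD eqxx.
have /hitA/set0Pn[x] : D \in F' by rewrite inE DF.
by rewrite !inE => /andP[xD xA]; exists x; rewrite !inE xD xA orbT.
Qed.

Lemma card_hit (I : finType) (D : I -> {set V}) (K : {set I}) (X : {set V}) :
  #|[set i in K | ~~ [disjoint D i & X]]| <= \sum_(x in X) #|[set i in K | x \in D i]|.
Proof.
apply: (@leq_trans #|\bigcup_(x in X) [set i in K | x \in D i]|).
  apply: subset_leq_card; apply/subsetP=> i; rewrite inE => /andP[iK].
  rewrite -setI_eq0 => /set0Pn[x /setIP[xD xX]]; apply/bigcupP; exists x => //.
  by rewrite inE iK.
elim/big_ind2: _ => [|m A n B leA leB|x _] //; first by rewrite cards0.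
by apply: leq_trans (leq_card_setU _ _) (leq_add leA leB).
Qed.

(** Only the |J| butterflies with centre outside [X] are counted. The other centres lie in [X] but
    not in [W], so |X :&: W| < |J|. Outside [X] each vertex of [W] has [d >= 1] and each centre has
    [d >= 2], which uses up |W :\: X| + |J| of the total, itself below |W| + 2|J|. So [X] meets
    fewer than |X :&: W| + |J| wings, hence at most 2|J| - 2 of the 2|J|. *)
Lemma hyperforest_two_survivors (I : finType) (D : I * bool -> {set V}) (c : I -> V)
    (X : {set V}) :
  hyperforest D setT -> (forall i j b, (c i \in D (j, b)) = (i == j)) -> #|X| < #|I| ->
  exists i j, [/\ i != j, [disjoint D i & X] & [disjoint D j & X]].
Proof.
move=> hyp cD ltX.
have inj_c : injective c.
  by move=> i j cij; have := cD i j true; rewrite cij cD eqxx => /esym/eqP.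
pose J := [set i | c i \notin X]; pose K := setX J [set: bool].
pose W := \bigcup_(i in K) D i; pose d x := #|[set i in K | x \in D i]|.
have cardK : #|K| = 2 * #|J| by rewrite cardsX cardsT card_bool mulnC.
have KJ i b : ((i, b) \in K) = (c i \notin X) by rewrite !inE andbT.
have cardJ : #|~: J| <= #|X :\: W|.
  rewrite -(card_imset _ inj_c); apply: subset_leq_card; apply/subsetP=> _ /imsetP[i + ->].
  rewrite !inE negbK => ciX; rewrite ciX andbT.
  apply/bigcupP=> -[[j b]]; rewrite KJ cD => + /eqP ij; by rewrite -ij ciX.
have Jn0 : 0 < #|J|.
  have := cardsC J; have := subset_leq_card (subsetDl X W); move: ltX cardJ; lia.
have le1 : (\sum_(x in W) d x).+1 <= #|W| + 2 * #|J|.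
  rewrite -(double_count (subxx W)) -cardK; apply: hyp; first exact: subsetT.
  by rewrite -card_gt0 cardK; lia.
have le2 : #|W :\: X| + #|J| <= \sum_(x in W :\: X) d x.
  have -> : #|J| = \sum_(x in W :\: X) (x \in c @: J).
    rewrite -(card_imset _ inj_c) -sum1_card big_mkcond [RHS]big_mkcond /=.
    apply: eq_bigr => x _; have [/imsetP[i iJ ->]|_] := boolP (x \in c @: J); last by case: ifP.
    move: iJ; rewrite !inE => iJ; rewrite iJ (_ : c i \in W) //.
    by apply/bigcupP; exists (i, true); rewrite ?KJ ?cD.
  rewrite -sum1_card -big_split /=; apply: leq_sum => x; rewrite inE => /andP[xX /bigcupP[i iK xi]].
  have [/imsetP[j jJ xj]|_] /= := boolP (x \in c @: J); last first.
    by rewrite addn0; apply/card_gt0P; exists i; rewrite inE iK.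
  rewrite /d (cardsD1 (j, true)) (cardsD1 (j, false)) !inE xj !cD eqxx !andbT.
  by move: jJ; rewrite inE xpair_eqE andbF => -> /=; lia.
have le3 : \sum_(x in W) d x = \sum_(x in W :\: X) d x + \sum_(x in W :&: X) d x.
  by rewrite addnC (big_setID X).
pose R := [set i in K | ~~ [disjoint D i & X]].
have le4 : #|R| <= \sum_(x in W :&: X) d x.
  rewrite (_ : R = [set i in K | ~~ [disjoint D i & W :&: X]]) ?card_hit //.
  apply/setP=> i; rewrite [LHS]inE [RHS]inE; have [iK|//] := boolP (i \in K); congr (~~ _).
  have sW : D i \subset W by apply/subsetP=> x xi; apply/bigcupP; exists i.
  by rewrite -!setI_eq0 setIA (setIidPl sW).
have : 1 < #|K :\: R|.
  have sRK : R \subset K by apply/subsetP=> i; rewrite inE => /andP[].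
  have := cardsID R K; rewrite (setIidPr sRK).
  have := cardsID X W; have := cardsID W X; rewrite (setIC X W).
  have := cardsC J; move: ltX cardJ Jn0 le1 le2 le3 le4; rewrite cardK; lia.
case/card_gt1P=> i [j [/setDP[iK iR] /setDP[jK jR] ij]]; exists i, j.
by split=> //; [apply: contraNT iR | apply: contraNT jR]; rewrite inE => ->; rewrite ?iK ?jK.
Qed.

End HyperforestTheory.

(** * Blocks of cacti *)

Section Components.
Variable K : sgraph.

Lemma sedge_connect_sym : connect_sym (@sedge K).
Proof. exact/sym_connect_sym/sedge_sym. Qed.

Lemma n_components_le1 : (forall u v : K, connect (@sedge K) u v) -> n_components K <= 1.
Proof.
move=> conn; apply/card_le1_eqP=> u v; rewrite !inE !andbT => /eqP<- /eqP<-.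
exact/(rootP sedge_connect_sym).
Qed.

Lemma n_components_gt0 (u : K) : 0 < n_components K.
Proof.
apply/card_gt0P; exists (root (@sedge K) u).
by rewrite !inE roots_root //; apply: sedge_connect_sym.
Qed.

Lemma n_components_gt1 (u v : K) : ~~ connect (@sedge K) u v -> 1 < n_components K.
Proof.
move=> nuv; apply/card_gt1P; exists (root (@sedge K) u), (root (@sedge K) v).
rewrite !inE !(roots_root sedge_connect_sym); split=> //.
by apply: contra nuv => /eqP/(rootP sedge_connect_sym).
Qed.

End Components.

Section Restricted.
Variable G : sgraph.
Implicit Types (A B : {set G}) (c p : seq G).

(** Connectivity of induced subgraphs is treated inside [G], so that unions and vertex deletions
    stay operations on sets instead of nested sigma types. *)
Definition restricted_edge A : rel G := [rel x y | [&& x -- y, x \in A & y \in A]].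

Definition connected_in A := {in A &, forall x y, connect (restricted_edge A) x y}.

Lemma restricted_connect_sym A : connect_sym (restricted_edge A).
Proof. by apply: sym_connect_sym => x y; rewrite /restricted_edge /= sedge_sym [_ && (y \in A)]andbC. Qed.

Lemma restricted_sub A B x y : A \subset B ->
  connect (restricted_edge A) x y -> connect (restricted_edge B) x y.
Proof.
move=> sAB; apply: connect_sub => u v /and3P[uv uA vA].
by apply: connect1; rewrite /restricted_edge /= uv !(subsetP sAB).
Qed.

Lemma connected_inU A B : connected_in A -> connected_in B -> A :&: B != set0 ->
  connected_in (A :|: B).
Proof.
move=> conA conB /set0Pn[z /setIP[zA zB]].
have toz x : x \in A :|: B -> connect (restricted_edge (A :|: B)) x z.
  by case/setUP=> xAB; [apply: (restricted_sub (subsetUl A B)); apply: conA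
    | apply: (restricted_sub (subsetUr A B)); apply: conB].
move=> x y xAB yAB; apply: connect_trans (toz x xAB) _.
by rewrite restricted_connect_sym toz.
Qed.

Lemma path_connected_in x p : path (@sedge G) x p -> connected_in [set y in x :: p].
Proof.
elim: p x => [|y p IHp] x /=.
  by move=> _ u v; rewrite !inE => /eqP-> /eqP->.
case/andP=> xy /IHp conp.
have -> : [set z in [:: x, y & p]] = [set x; y] :|: [set z in y :: p].
  by apply/setP=> z; rewrite !inE; case: (z == x); case: (z == y).
apply: connected_inU => //; last by apply/set0Pn; exists y; rewrite !inE eqxx orbT.
have xy1 : connect (restricted_edge [set x; y]) x y.
  by apply: connect1; rewrite /restricted_edge /= xy set21 set22.
move=> u v; rewrite !inE => /orP[]/eqP-> /orP[]/eqP-> //.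
by rewrite restricted_connect_sym.
Qed.

Lemma cycle_connected_in c : is_cycle c -> connected_in [set x in c].
Proof.
case: c => [[]|x p] // [_ /andP[]]; rewrite /= rcons_path => /andP[xp _] _.
exact: path_connected_in.
Qed.

Lemma cycle_connected_inD1 c z : is_cycle c -> connected_in ([set x in c] :\ z).
Proof.
move=> cyc; have [zc|zNc] := boolP (z \in c); last first.
  suff -> : [set x in c] :\ z = [set x in c] by apply: cycle_connected_in.
  by apply/setDidPl; rewrite disjoint_sym disjoints1 inE.
have [a [q [cyc' _ eqc]]] := is_cycle_split cyc zc.
have -> : [set x in c] :\ z = [set x in a :: q].
  apply/setP=> x; rewrite !inE -eqc inE; have := is_cycle_uniq cyc'.
  rewrite cons_uniq => /andP[zN _]; have [->|//] := eqVneq x z.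
  by rewrite -[RHS]in_cons (negPf zN).
case: cyc' => _ /andP[]; rewrite /= rcons_path => /and3P[_ aq _] _.
exact: path_connected_in.
Qed.

Lemma restricted_connect_lift (K : sgraph) (f : K -> G) A u v : injective f ->
  (forall u v, f u -- f v -> u -- v) -> (forall x, x \in A -> exists u, f u = x) ->
  connect (restricted_edge A) (f u) (f v) -> connect (@sedge K) u v.
Proof.
move=> inj hom surj /connectP[p]; elim: p u => [|x p IHp] u /=.
  by move=> _ /inj->.
case/andP=> /and3P[ux _ /surj[w ew]]; rewrite -ew in ux * => pw ev.
exact: connect_trans (connect1 (hom _ _ ux)) (IHp w pw ev).
Qed.

(** A cutvertex has to increase the number of components. Here [induced B] has at least one
    component, and after deletion of [z] there is at most one. *)
Lemma nonseparableI B : B != set0 -> connected_in B ->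
  (forall z, z \in B -> connected_in (B :\ z)) -> nonseparable (induced B).
Proof.
move=> Bn0 conB conD; pose f : induced B -> G := val.
have inj_f : injective f by apply: val_inj.
have conn (u v : induced B) : connect (@sedge (induced B)) u v.
  apply: (restricted_connect_lift inj_f _ _ (conB (f u) (f v) (valP u) (valP v))) => //.
  by move=> x xB; exists (exist _ x xB).
have [x xB] := set0Pn _ Bn0; split.
  by split=> //; apply/card_gt0P; exists (exist _ x xB).
move=> z; rewrite /cutvertex; apply/negP; rewrite -leqNgt.
apply: leq_trans (n_components_gt0 (exist _ x xB : induced B)).
apply: n_components_le1 => u v; pose h : delete [set z] -> G := f \o val.
have inj_h : injective h by apply: inj_comp val_inj.
have hB w : h w \in B :\ f z.
  rewrite !inE (valP (val w)) andbT (inj_eq inj_f).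
  by have := valP w; rewrite !inE.
apply: (restricted_connect_lift inj_h _ _ (conD _ (valP z) (h u) (h v) (hB u) (hB v))) => //.
move=> y /setD1P[yNz yB]; have zN : (exist _ y yB : induced B) \in ~: [set z].
  by rewrite !inE -(inj_eq inj_f).
by exists (exist _ (exist _ y yB : induced B) zN : delete [set z]).
Qed.

Lemma block_extend B : nonseparable (induced B) ->
  exists2 B' : {set G}, B \subset B' & block B'.
Proof.
have [n] := ubnP #|~: B|; elim: n B => // n IH B leB nsB.
have [maxB|] := classic (block B); first by exists B.
move=> nblock; apply: NNPP => none; case: nblock; split=> // C sBC nsC.
apply: NNPP => CNB; apply: none.
have [|C' sCC' bC'] := IH C _ nsC; last by exists C'; rewrite // (subset_trans sBC).
rewrite -ltnS; apply: leq_trans leB; rewrite ltnS proper_card // properE !setCS sBC.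
by apply: contra_notN CNB => sCB; apply/eqP; rewrite eqEsubset sCB.
Qed.

End Restricted.

Lemma cycle_edge3 n (i a b y : 'I_n.+3) : cycle_edge i a -> cycle_edge i b ->
  cycle_edge i y -> a != b -> y \in [set a; b].
Proof.
rewrite /cycle_edge !inE; have inj := can_inj (@ordSK n.+3).
have eqi j1 j2 : i = ordS j1 -> i = ordS j2 -> j1 = j2 by move=> -> /inj.
move=> /orP[]/eqP ea /orP[]/eqP eb /orP[]/eqP ey.
- by rewrite ea eb eqxx.
- by rewrite ea eb eqxx.
- by rewrite ey ea eqxx.
- by rewrite (eqi _ _ ey eb) eqxx orbT.
- by rewrite ey eb eqxx orbT.
- by rewrite (eqi _ _ ey ea) eqxx.
- by rewrite (eqi _ _ ea eb) eqxx.
by rewrite (eqi _ _ ea eb) eqxx.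
Qed.

(** In such a block a vertex of [c] has no neighbours besides its two neighbours on [c]. As no edge
    of the block leaves [c], connectedness then makes [c] span the block. *)
Lemma cycle_block_closed (G : sgraph) (B : {set G}) (c : seq G) n :
  graph_iso (induced B) (cycle_graph n) -> is_cycle c -> [set x in c] \subset B ->
  forall x y, x \in c -> y \in B -> x -- y -> [set x; y] \in cycle_edges c.
Proof.
move=> [f /bij_inj inj fm] cyc /subsetP sc x y xc yB xy.
have [a [b [aNb [ac bc xa xb] ea eb]]] := cycle_nbrs cyc xc.
have inB z : z \in c -> z \in B by move=> zc; apply: sc; rewrite inE.
pose u z (zB : z \in B) : induced B := exist _ z zB.
have := @cycle_edge3 n (f (u x (inB x xc))) (f (u a (inB a ac)))
  (f (u b (inB b bc))) (f (u y yB)).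
rewrite ![cycle_edge _ _]fm => /(_ xa xb xy); rewrite (inj_eq inj).
by move=> /(_ aNb); rewrite !inE !(inj_eq inj) => /orP[]/eqP[->].
Qed.

Lemma cycle_spans_block (G : sgraph) (B : {set G}) (c : seq G) n :
  graph_iso (induced B) (cycle_graph n) -> is_cycle c -> [set x in c] \subset B ->
  connected (induced B) -> B \subset [set x in c].
Proof.
move=> iso cyc sc [_ con]; apply/subsetP=> y yB.
have [x xc] : exists x, x \in c.
  by case: c cyc {sc} => [[]|x p] // _; exists x; rewrite mem_head.
have xB : x \in B by apply: (subsetP sc); rewrite inE.
have closed (u : induced B) p : val u \in c -> path (@sedge (induced B)) u p ->
    val (last u p) \in c.
  elim: p u => [|w p IHp] u uc //= /andP[uw]; apply: IHp.
  have := cycle_block_closed iso cyc sc uc (valP w) uw.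
  case/(cycle_edgeP cyc)=> a [b [/setP/(_ (val w)) + ac bc _]].
  by rewrite !inE eqxx orbT => /esym/orP[]/eqP->.
have /connectP[p up ey] := con (exist _ x xB) (exist _ y yB).
by rewrite inE; have := closed (exist _ x xB) p xc up; rewrite -ey.
Qed.

(** The union of the two cycles is nonseparable: deleting any vertex leaves both connected, and a
    second common vertex still joins them. The block around it has more than two vertices, so it is
    a cycle, which both cycles span. *)
Lemma cactus_cycles (G : sgraph) : cactus G -> forall c1 c2 : seq G,
  is_cycle c1 -> is_cycle c2 -> 1 < #|[set x in c1] :&: [set x in c2]| ->
  cycle_edges c1 = cycle_edges c2.
Proof.
move=> cac c1 c2 cyc1 cyc2 common.
set C1 := [set x in c1] in common *; set C2 := [set x in c2] in common *.
have [x] : exists x, x \in C1 :&: C2 by apply/card_gt0P; apply: ltnW.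
move=> x12; have ns : nonseparable (induced (C1 :|: C2)).
  apply: nonseparableI.
  - by apply/set0Pn; exists x; case/setIP: x12 => x1 _; rewrite inE x1.
  - apply: connected_inU; try exact: cycle_connected_in.
    by apply/set0Pn; exists x.
  move=> z _; rewrite setDUl; apply: connected_inU; try exact: cycle_connected_inD1.
  rewrite -setDIl -card_gt0; have := cardsD1 z (C1 :&: C2); move: common.
  by case: (z \in _); lia.
have [B sB bB] := block_extend ns; have [[conB _] _] := bB.
have s1 : C1 \subset B := subset_trans (subsetUl _ _) sB.
have s2 : C2 \subset B := subset_trans (subsetUr _ _) sB.
have B3 : 2 < #|B|.
  by apply: leq_trans (subset_leq_card s1); rewrite card_cycle //; case: cyc1.
have cardB m : #|induced B| = m -> #|B| = m by rewrite card_sig => <-; apply: eq_card.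
case: (cac B bB) => [/card_graph_iso|/card_graph_iso|[n iso]].
- by rewrite card_ord => /cardB eB; rewrite eB in B3.
- by rewrite card_ord => /cardB eB; rewrite eB in B3.
have sub c c' : is_cycle c -> is_cycle c' -> [set x in c] \subset B -> [set x in c'] \subset B ->
    cycle_edges c \subset cycle_edges c'.
  move=> cyc cyc' sc sc'; apply/subsetP=> e /(cycle_edgeP cyc)[a [b [-> ac bc ab]]].
  have inB z : z \in c -> z \in B by move=> zc; apply: (subsetP sc); rewrite inE.
  apply: (cycle_block_closed iso cyc' sc') => //; last exact: inB.
  by have /subsetP/(_ a (inB a ac)) := cycle_spans_block iso cyc' sc' conB; rewrite inE.
by apply/eqP; rewrite eqEsubset !sub.
Qed.

(** * Connected obstructions *)

Lemma is_support_gt2 (G : sgraph) (T : {set G}) : is_support T -> 2 < #|T|.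
Proof. by case=> c cyc <-; rewrite card_cycle //; case: cyc. Qed.

Lemma disjoint_supp (G : sgraph) (c : seq G) (X : {set G}) :
  [disjoint [set x in c] & X] = [disjoint c & X].
Proof. by apply: eq_disjoint => x; rewrite inE. Qed.

Lemma not_apexI k (G : sgraph) :
  (forall X : {set G}, #|X| <= k -> exists T1 T2,
    [/\ is_support T1, is_support T2, [disjoint T1 & X], [disjoint T2 & X] & T1 != T2]) ->
  ~ apex k sub_unicyclic G.
Proof.
move=> two /apexP[X leX one]; have [_ [_ [[c1 cyc1 <-] [c2 cyc2 <-]]]] := two X leX.
rewrite !disjoint_supp => d1 d2 /eqP; apply.
exact: eq_cycle_edges_supp (one _ _ cyc1 cyc2 d1 d2).
Qed.

Lemma not_apexE k (G : sgraph) (X : {set G}) : ~ apex k sub_unicyclic G -> #|X| <= k ->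
  exists c1 c2, [/\ is_cycle c1, is_cycle c2, [disjoint c1 & X], [disjoint c2 & X]
    & cycle_edges c1 <> cycle_edges c2].
Proof.
move=> napex leX; apply: NNPP => none; apply: napex; apply/apexP; exists X => //.
move=> c1 c2 cyc1 cyc2 d1 d2; apply: NNPP => neq; apply: none.
by exists c1, c2.
Qed.

(** The certificate against membership. It asks nothing of the graph beyond the family, and so
    applies to graphs obtained by deleting or contracting an edge. *)
Lemma survivors_not_apex k (G : sgraph) (I : finType) (D : I * bool -> {set G}) (c : I -> G) :
  (forall p, is_support (D p)) -> hyperforest D setT ->
  (forall i j b, (c i \in D (j, b)) = (i == j)) -> #|I| = k.+1 ->
  ~ apex k sub_unicyclic G.
Proof.
move=> cycD hyp cD cardI; apply: not_apexI => X leX.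
have [|p [q [pq dp dq]]] := hyperforest_two_survivors hyp cD (X := X).
  by rewrite cardI.
exists (D p), (D q); split=> //; apply: contraTneq pq => eqD; apply/negP=> pq.
(* If the survivors had the same vertex set, the inequality for this pair would read 2|D q| + 1 <=
   |D q| + 2, impossible for at least three vertices. *)
have := hyp [set p; q] (subsetT _); rewrite !big_setU1 ?big_set1 ?inE //= eqD setUid.
rewrite cards2 pq; have := is_support_gt2 (cycD q).
have : [set p; q] != set0 by apply/set0Pn; exists p; rewrite set21.
by move=> -> ? /(_ isT); lia.
Qed.

Lemma crossing_edge (G : sgraph) (T : {set G}) x y : connect (@sedge G) x y ->
  x \in T -> y \notin T -> exists a b, [/\ a \in T, b \notin T & a -- b].
Proof.
case/connectP=> p; elim: p x => [|z p IHp] x /= => [_ -> ->//|/andP[xz pz] ey xT yT].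
have [zT|zNT] := boolP (z \in T); first exact: IHp pz ey zT yT.
by exists x, z.
Qed.

(** [is_support] has no boolean form; classical logic collects all supports into one finite
    family. *)
Lemma subset_of_Prop (T : finType) (P : T -> Prop) : exists A : {set T}, forall x, x \in A <-> P x.
Proof.
have [x|f fP] := @fin_all_exists T (fun=> bool) (fun x b => b <-> P x).
  by have [Px|nPx] := classic (P x); [exists true | exists false].
by exists [set x | f x] => x; rewrite inE.
Qed.

Lemma delete_edge_support (G : sgraph) (a b : G) (T : {set G}) : is_support T ->
  ~~ ((a \in T) && (b \in T)) -> is_support (G := delete_edge [set a; b]) T.
Proof.
move=> [c cyc <-] nab; exists c => //; apply: delete_edge_cycle => //.
apply: contra nab => /(cycle_edgeP cyc)[u [v [/setP eqe uc vc _]]].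
have inc z : z \in [set a; b] -> z \in [set x in c].
  by rewrite eqe !inE => /orP[]/eqP->.
by rewrite !inc ?set21 ?set22.
Qed.

Section ConnectedObstruction.
Variables (k : nat) (G : sgraph).
Hypothesis conG : connected G.
Hypothesis obsG : obs (apex k sub_unicyclic) G.
Hypothesis cycG : forall c1 c2 : seq G, is_cycle c1 -> is_cycle c2 ->
  1 < #|[set x in c1] :&: [set x in c2]| -> cycle_edges c1 = cycle_edges c2.

Lemma support_meet (T1 T2 : {set G}) : is_support T1 -> is_support T2 -> T1 != T2 ->
  #|T1 :&: T2| <= 1.
Proof.
move=> [c1 cyc1 <-] [c2 cyc2 <-]; rewrite leqNgt; apply: contra => /(cycG cyc1 cyc2).
by move/eq_cycle_edges_supp=> -> //.
Qed.

(* A packing of k + 2 cycles survives the deletion of an edge leaving one of them. *)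
Lemma obs_packing_bound (P : {set {set G}}) : (forall T, T \in P -> is_support T) ->
  trivIset P -> #|P| <= k.+1.
Proof.
move=> cycP trivP; rewrite leqNgt; apply/negP=> ltP.
have [T1 [T2 [T1P T2P T12]]] : exists T1 T2, [/\ T1 \in P, T2 \in P & T1 != T2].
  by apply/card_gt1P; lia.
have d12 : [disjoint T1 & T2] by have /trivIsetP := trivP; apply.
have ne T : T \in P -> exists x, x \in T.
  by move=> /cycP/is_support_gt2 T3; apply/card_gt0P; lia.
have [x xT1] := ne _ T1P; have [y yT2] := ne _ T2P.
have [a [b [aT bT ab]]] := crossing_edge (conG.2 x y) xT1 (negbT (disjointFl d12 yT2)).
(* The edge leaves [T1], and its end [a] lies in no other member, so it belongs to no cycle of the
   packing. *)
have cycP' T : T \in P -> is_support (G := delete_edge [set a; b]) T.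
  move=> TP; apply: delete_edge_support; first exact: cycP.
  have [->|TNT1] := eqVneq T T1; first by rewrite (negPf bT) andbF.
  have dT : [disjoint T & T1] by have /trivIsetP := trivP; apply.
  by rewrite (disjointFl dT aT).
apply: (@not_apexI k (delete_edge [set a; b])) (obs_delete_edge obsG ab) => X leX.
(* A vertex of [X] hits at most one of these disjoint sets, so at least (k + 2) - k of them are
   left. *)
have : 1 < #|P :\: [set T in P | ~~ [disjoint T & X]]|.
  have := cardsID [set T in P | ~~ [disjoint T & X]] P.
  have := subset_leq_card (subsetIr P [set T in P | ~~ [disjoint T & X]]).
  have hit : #|[set T in P | ~~ [disjoint T & X]]| <= \sum_(x in X) #|[set T in P | x \in T]|.
    exact: card_hit.
  have : \sum_(x in X) #|[set T in P | x \in T]| <= #|X|.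
    rewrite -sum1_card; apply: leq_sum => z _; apply/card_le1_eqP=> T T'; rewrite !inE.
    move=> /andP[TP zT] /andP[TP' zT']; apply/eqP; apply: contraT => TT'.
    have dT : [disjoint T' & T] by have /trivIsetP := trivP; apply.
    by rewrite (disjointFl dT zT) in zT'.
  by move: ltP leX hit; lia.
case/card_gt1P=> T [T' [/setDP[TP nT] /setDP[TP' nT'] TT']]; exists T, T'.
split=> //; try exact: cycP'.
  by apply: contraNT nT; rewrite inE TP.
by apply: contraNT nT'; rewrite inE TP'.
Qed.

Lemma obs_butterflies : exists (I : finType) (D : I * bool -> {set G}) (c : I -> G),
  [/\ #|I| = k.+1, forall p, is_support (D p), hyperforest D setT,
      forall p q, p != q -> #|D p :&: D q| <= 1
    & forall i j b, (c i \in D (j, b)) = (i == j)].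
Proof.
have [F FP] := subset_of_Prop (@is_support G).
have hypF : hyperforest id F.
  apply: cycles_hyperforest => // [T /FP//|T1 T2 /FP s1 /FP s2]; exact: support_meet.
have [|A [P [sP trivP leA] hitA]] := hyperforest_hitting_packing _ hypF.
  by move=> T /FP/is_support_gt2; rewrite -card_gt0; lia.
have leP : #|P| <= k.+1 by apply: obs_packing_bound => // T /(subsetP sP)/FP.
have [napex _] := obsG.
have gtA : k < #|A|.
  rewrite ltnNge; apply/negP=> /(not_apexE napex)[c [_ [cyc _ dA _ _]]].
  have /hitA : [set x in c] \in F by apply/FP; exists c.
  by rewrite setI_eq0 disjoint_supp dA.
pose I : finType := {x : G | x \in A}.
have cardI : #|I| = #|A| by rewrite card_sig; apply: eq_card.
have [i|DD DDP] := @fin_all_exists I (fun=> ({set G} * {set G})%type)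
  (fun i T => [/\ is_support T.1, is_support T.2, T.1 != T.2,
     T.1 :&: A = [set val i] & T.2 :&: A = [set val i]]).
  have [|c1 [c2 [cyc1 cyc2 d1 d2 neq]]] := not_apexE (X := A :\ val i) napex.
    by have := cardsD1 (val i) A; rewrite (valP i); lia.
  have hit1 c : is_cycle c -> [disjoint c & A :\ val i] -> [set x in c] :&: A = [set val i].
    move=> cyc dc; have /hitA : [set x in c] \in F by apply/FP; exists c.
    have sub z : z \in [set x in c] :&: A -> z = val i.
      rewrite !inE => /andP[zc zA]; apply/eqP; apply: contraFT (disjointFr dc zc).
      by rewrite !inE zA andbT => ->.
    case/set0Pn=> z zAc; apply/setP=> y; rewrite [RHS]inE; apply/idP/eqP => [/sub//|->].
    by rewrite -(sub z zAc).
  exists ([set x in c1], [set x in c2]) => /=; split; try by [exists c1 | exists c2 | apply: hit1].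
  (* [not_apexE] separates edge sets only; two cycles on the same vertices share more than one of
     them, so [cycG] would make their edge sets equal. *)
  apply/eqP=> eqs; apply: neq; apply: cycG => //.
  by rewrite -eqs setIid card_cycle //; case: cyc1 => /ltnW.
pose D (p : I * bool) := if p.2 then (DD p.1).1 else (DD p.1).2.
have cycD p : is_support (D p) by rewrite /D; have [? ? _ _ _] := DDP p.1; case: p.2.
have DA p : D p :&: A = [set val p.1] by rewrite /D; have [_ _ _ ? ?] := DDP p.1; case: p.2.
have injD p q : p != q -> D p != D q.
  apply: contra => /eqP eqD; have /val_inj e1 : val p.1 = val q.1.
    by apply: set1_inj; rewrite -!DA eqD.
  case: p q e1 eqD => [i b] [j b'] /= <-; rewrite /D /=; have [_ _ /eqP ne _ _] := DDP i.
  by case: b; case: b' => // e; case: ne.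
have meetD p q : p != q -> #|D p :&: D q| <= 1.
  by move/injD; apply: support_meet.
exists I, D, val; split=> //; first by rewrite cardI; lia.
  by apply: cycles_hyperforest => // p q _ _; apply: meetD.
move=> i j b; have /setP/(_ (val i)) := DA (j, b).
by rewrite !inE (valP i) andbT => ->; rewrite (inj_eq val_inj).
Qed.

End ConnectedObstruction.

(** * What minimality says about a system of k + 1 butterflies *)

Section ButterflyObstruction.
Variables (k : nat) (G : sgraph) (I : finType) (D : I * bool -> {set G}) (c : I -> G).
Hypothesis obsG : obs (apex k sub_unicyclic) G.
Hypothesis cardI : #|I| = k.+1.
Hypothesis cycD : forall p, is_support (D p).
Hypothesis hypD : hyperforest D setT.
Hypothesis meetD : forall p q, p != q -> #|D p :&: D q| <= 1.
Hypothesis centerD : forall i j b, (c i \in D (j, b)) = (i == j).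

Lemma obs_edge_covered (a b : G) : a -- b -> exists p, (a \in D p) && (b \in D p).
Proof.
move=> ab; apply: NNPP => none.
apply: (@survivors_not_apex k (delete_edge [set a; b]) I D c) (obs_delete_edge obsG ab) => // p.
apply: delete_edge_support => //; apply/negP=> abp; apply: none.
by exists p.
Qed.

Lemma contract_map_in_inj (x y : G) (xy : x -- y) (T : {set G}) :
  ~~ ((x \in T) && (y \in T)) -> {in T &, injective (contract_map xy)}.
Proof.
move=> nxy u v uT vT /contract_map_eq[//|]; rewrite !inE.
move=> /andP[/orP[]/eqP eu /orP[]/eqP ev]; subst => //; case/andP: nxy => //.
Qed.

Lemma contract_support (x y : G) (xy : x -- y) (T : {set G}) : is_support T ->
  ~~ ((x \in T) && (y \in T)) -> is_support (contract_map xy @: T).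
Proof.
move=> [d cyd <-] nxy; have inj := contract_map_in_inj (xy := xy) nxy.
exists (map (contract_map xy) d).
  apply: map_cycle_hom => // u v ud vd; first by apply: inj; rewrite inE.
  move=> uv; apply: contract_map_hom => //; apply: contraTneq uv => /inj->; rewrite ?inE //.
  by rewrite sedge_irrefl.
apply/setP=> z; rewrite inE; apply/mapP/imsetP=> -[u ud ->]; exists u => //.
  by rewrite inE.
by rewrite inE in ud.
Qed.

(** Four named vertices ensure that three remain. The image of [y] stands for both ends, so the edge
    [v -- x] supplies its link to [v]. *)
Lemma contract_cycle (v x y z : G) (q : seq G) (xy : x -- y) :
  is_cycle [:: v, x, y, z & q] ->
  is_cycle (map (contract_map xy) [:: v, y, z & q]).
Proof.
move=> cyc; have Uc := is_cycle_uniq cyc; have [_ /andP[cy _]] := cyc.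
set s := [:: v, y, z & q]; pose f := contract_map xy.
have [xNv xNs] : x != v /\ x \notin s.
  move: Uc; rewrite /= !inE !negb_or => /and3P[/and4P[vx _ _ _] /and3P[xy' xz xq] _].
  by rewrite eq_sym vx xy' xz xq.
have inj : {in s &, injective f}.
  have nxy : ~~ ((x \in [set t in s]) && (y \in [set t in s])) by rewrite !in_set (negPf xNs).
  by move=> u w us ws; apply: (contract_map_in_inj nxy); rewrite in_set.
have Us : uniq s by move: Uc; rewrite /s /= !inE !negb_or => /and3P[/and4P[_ -> -> ->] _ ->].
have hom : {in s &, forall u w, u -- w -> f u -- f w}.
  move=> u w us ws uw; apply: contract_map_hom => //; apply: contraTneq uw => /inj->//.
  by rewrite sedge_irrefl.
split; first by rewrite size_map.
rewrite /ucycle map_inj_in_uniq // Us andbT.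
move: cy; rewrite [s]lock /= !rcons_path -lock => /and5P[vx _ yz zq qv].
have -> : cycle (@sedge (contract x y)) (map f s) =
  [&& f v -- f y, f y -- f z, path (@sedge _) (f z) (map f q) & last (f z) (map f q) -- f v].
  by rewrite /= rcons_path.
apply/and4P; split.
- have -> : f y = f x by rewrite /f contract_map_x contract_map_y.
  apply: contract_map_hom => //; rewrite /f contract_map_x -(contract_map_y xy).
  have vy : v != y by move: Us; rewrite cons_uniq in_cons negb_or => /andP[/andP[]].
  by apply: contraNneq vy => e; apply/eqP/inj => //; rewrite !in_cons eqxx ?orbT.
- by apply: hom; rewrite ?inE ?eqxx ?orbT.
- apply: (homo_path_in (P := mem s) hom) zq; apply/allP=> t tq.
  by rewrite -[X in is_true X]/(t \in s) 2!in_cons tq !orbT.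
rewrite last_map; apply: hom => //; last by rewrite mem_head.
by rewrite 2!in_cons mem_last !orbT.
Qed.

(* Contracting an edge that avoids the centre of its own cycle keeps the system
   of butterflies, so a cycle of length at least 4 contradicts minimality. *)
Lemma obs_triangle p : #|D p| = 3.
Proof.
apply/eqP; rewrite eqn_leq is_support_gt2 // andbT leqNgt; apply/negP=> D4.
have [d cyd eqd] := cycD p; case: p => i0 b0 in D4 eqd.
have cd : c i0 \in d by have := centerD i0 i0 b0; rewrite eqxx -eqd inE.
have [x [q [cyc _ eqc]]] := is_cycle_split cyd cd.
have {d cyd cd eqd eqc}eqD : D (i0, b0) = [set t in [:: c i0, x & q]].
  by rewrite -eqd; apply/setP=> t; rewrite !inE -eqc !inE.
have : 3 < size [:: c i0, x & q] by rewrite -card_cycle // -eqD.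
case: q cyc eqD => [|y [|z q]] //= cyc eqD _.
have xy : x -- y by have [_ /andP[/= /and3P[]]] := cyc.
have Uc := is_cycle_uniq cyc.
have [vx vy xNy] : [/\ c i0 != x, c i0 != y & x != y].
  move: Uc; rewrite /= !inE !negb_or => /and3P[/and4P[-> -> _ _] /and3P[-> _ _] _].
  by [].
have xD : x \in D (i0, b0) by rewrite eqD !inE eqxx orbT.
have yD : y \in D (i0, b0) by rewrite eqD !inE eqxx !orbT.
have notc i t : t \in D (i0, b0) -> c i0 != t -> c i != t.
  by move=> tD; apply: contraNneq => e; move: tD; rewrite -e centerD => /eqP->.
pose f := contract_map xy; pose D' p := f @: D p.
have nxy p : p != (i0, b0) -> ~~ ((x \in D p) && (y \in D p)).
  move/meetD; apply: contraL => /andP[xp yp]; rewrite -ltnNge.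
  have <- : #|[set x; y]| = 2 by rewrite cards2 xNy.
  by apply: subset_leq_card; apply/subsetP=> t; rewrite !inE => /orP[]/eqP->; rewrite ?xp ?yp ?xD ?yD.
have cycD' p : is_support (D' p).
  have [->|/nxy] := eqVneq p (i0, b0); last exact: contract_support.
  exists (map f [:: c i0, y, z & q]); first exact: contract_cycle.
  apply/setP=> t; rewrite inE /D' eqD; apply/mapP/imsetP=> -[u us ->].
    by exists u => //; move: us; rewrite !inE => /or4P[]->; rewrite ?orbT.
  move: us; rewrite inE in_cons => /predU1P[->|]; first by exists (c i0); rewrite ?mem_head.
  rewrite in_cons => /predU1P[->|us]; last by exists u => //; rewrite in_cons us orbT.
  by exists y; rewrite ?inE ?eqxx ?orbT // /f contract_map_x contract_map_y.
have centerD' i j b : (f (c i) \in D' (j, b)) = (i == j).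
  rewrite -(centerD i j b); apply/imsetP/idP => [[w wD]|cD]; last by exists (c i).
  move/contract_map_eq=> [->//|]; rewrite !inE.
  by rewrite (negPf (notc i x xD vx)) (negPf (notc i y yD vy)).
(* A contraction costs a set at most one vertex, and only if both ends belong to it. *)
have cardf (U : {set G}) : #|U| <= #|f @: U| + ((x \in U) && (y \in U)).
  have [/andP[xU yU]|/(contract_map_in_inj (xy := xy)) inj] := boolP (_ && _); last first.
    by rewrite addn0 card_in_imset.
  have inj : {in U :\ y &, injective f}.
    by apply: contract_map_in_inj; rewrite !inE eqxx andbF.
  rewrite (cardsD1 y U) yU -(card_in_imset inj) addnC leq_add2r subset_leq_card //.
  exact/imsetS/subsetDl.
have hyp' : hyperforest D' setT.
  move=> J _ Jn0; have -> : \bigcup_(j in J) D' j = f @: \bigcup_(j in J) D j.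
    by rewrite (big_morph _ (imsetU f) (imset0 f)).
  set U := \bigcup_(j in J) D j; have := cardf U.
  (* If the shortened cycle belongs to the family, the vertex it loses lowers the sum and pays for
     the one that the union may lose. *)
  have [pJ|pNJ] := boolP ((i0, b0) \in J).
    have cardD' : #|D' (i0, b0)| < #|D (i0, b0)|.
      have inj : {in D (i0, b0) :\ y &, injective f}.
        by apply: contract_map_in_inj; rewrite !inE eqxx andbF.
      rewrite [ltnRHS](cardsD1 y) yD ltnS -(card_in_imset inj); apply: subset_leq_card.
      apply/subsetP=> _ /imsetP[u uD ->]; have [->|uNy] := eqVneq u y; last first.
        by apply: imset_f; rewrite !inE uNy.
      rewrite (_ : f y = f x) ?imset_f ?inE ?xNy //.
      by rewrite /f contract_map_x contract_map_y.
    have lt : \sum_(j in J) #|D' j| < \sum_(j in J) #|D j|.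
      rewrite (bigD1 _ pJ) [ltnRHS](bigD1 _ pJ) /= -addSn leq_add //.
      by apply: leq_sum => j _; apply: leq_imset_card.
    by have := hypD (subsetT J) Jn0; rewrite -/U; case: (_ && _); move: lt; lia.
  have le : \sum_(j in J) #|D' j| <= \sum_(j in J) #|D j|.
    by apply: leq_sum => j _; apply: leq_imset_card.
  have [/andP[xU yU]|_] := boolP (_ && _); last by have := hypD (subsetT J) Jn0; rewrite -/U; lia.
  (* Here the union loses a vertex but the sum need not drop. Adding the shortened cycle to [J]
     shows a slack of one: the cycle meets [U] in both [x] and [y], whereas the inequality for [J]
     alone would allow for a single common vertex. *)
  have := hypD (subsetT ((i0, b0) |: J)); rewrite -card_gt0 cardsU1 pNJ !big_setU1 //= -/U => /(_ isT).
  have := cardsUI (D (i0, b0)) U.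
  have : 1 < #|D (i0, b0) :&: U|.
    have <- : #|[set x; y]| = 2 by rewrite cards2 xNy.
    by apply: subset_leq_card; apply/subsetP=> t; rewrite !inE => /orP[]/eqP->; rewrite ?xU ?yU ?xD ?yD.
  move=> lt1 eq1 lt2 le1; apply: leq_ltn_trans le _; move: lt1 eq1 lt2 le1.
  set w := #|f @: U|; set S := \sum_(j in J) #|D j|; set d := #|D (i0, b0)|; set n := #|J|.
  by set m := #|_ :&: _|; set l := #|_ :|: _|; lia.
exact: survivors_not_apex cycD' hyp' centerD' cardI (obs_contract obsG xy).
Qed.

End ButterflyObstruction.

(** * Gluing *)

Section Glue.
Variables (G H : sgraph) (x : G) (y : H).

Definition glue_left (u : G) : glue x y := inl u.

(** Makes the two sides symmetric: [y], absent from the second summand, is sent to the common vertex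
    [inl x]. *)
Definition glue_right (v : H) : glue x y :=
  if insub v is Some z then inr z else inl x.

Lemma glue_right_val (z : {v : H | v != y}) : glue_right (val z) = inr z.
Proof. by rewrite /glue_right valK. Qed.

Lemma glue_right_base : glue_right y = glue_left x.
Proof. by rewrite /glue_right insubF ?eqxx. Qed.

Variant glue_spec : glue x y -> Prop :=
| GlueLeft u : glue_spec (glue_left u)
| GlueRight v of v != y : glue_spec (glue_right v).

Lemma glueP w : glue_spec w.
Proof.
case: w => [u|z]; first exact: GlueLeft.
by rewrite -glue_right_val; apply: (@GlueRight (val z)); apply: (valP z).
Qed.

Lemma glue_right_sub v (vy : v != y) : glue_right v = inr (exist _ v vy).
Proof. by rewrite -glue_right_val. Qed.

Lemma glue_left_inj : injective glue_left.
Proof. by move=> u v []. Qed.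

Lemma glue_left_right u v : glue_left u = glue_right v -> u = x /\ v = y.
Proof.
have [->|vy] := eqVneq v y; first by rewrite glue_right_base => /glue_left_inj.
by rewrite glue_right_sub.
Qed.

Lemma glue_right_inj : injective glue_right.
Proof.
move=> u v; have [->|uy] := eqVneq u y.
  by rewrite glue_right_base => /glue_left_right[].
have [->|vy] := eqVneq v y.
  by rewrite glue_right_base => /esym/glue_left_right[].
by rewrite !glue_right_sub => -[].
Qed.

Lemma glue_left_edge u v : (glue_left u -- glue_left v) = (u -- v).
Proof. by []. Qed.

Lemma glue_cross_edge u v : v != y ->
  (glue_left u -- glue_right v) = (u == x) && (y -- v).
Proof. by move=> vy; rewrite glue_right_sub. Qed.

Lemma glue_right_edge u v : (glue_right u -- glue_right v) = (u -- v).
Proof.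
have [->|uy] := eqVneq u y; have [->|vy] := eqVneq v y.
- by rewrite !sedge_irrefl.
- by rewrite glue_right_base glue_cross_edge // eqxx.
- by rewrite sedge_sym glue_right_base glue_cross_edge // eqxx sedge_sym.
by rewrite !glue_right_sub.
Qed.

(** Two graphs drawn in a common [V] and meeting in one vertex form a [glue]. [E1] and [E2] are
    relations rather than graphs, since in use each is only a part of the edges of [G]. A pair of
    vertices common to both sides is a single vertex twice, and loops are excluded, so neither
    relation adds edges to the other side. *)
Lemma glue_embedding (V : eqType) (E1 E2 : rel V) (h : G -> V) (g : H -> V) :
  symmetric E1 -> symmetric E2 ->
  injective h -> injective g -> h x = g y ->
  (forall u v, h u = g v -> u = x) ->
  (forall u v, (u -- v) = E1 (h u) (h v)) -> (forall u v, (u -- v) = E2 (g u) (g v)) ->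
  (forall s t, E1 s t -> exists u, h u = s) -> (forall s t, E2 s t -> exists v, g v = s) ->
  exists f : glue x y -> V, [/\ injective f, forall u, f (glue_left u) = h u,
    forall v, f (glue_right v) = g v & forall u v, (u -- v) = E1 (f u) (f v) || E2 (f u) (f v)].
Proof.
move=> sym1 sym2 inj_h inj_g hxy cross e1 e2 s1 s2.
pose f (w : glue x y) := match w with inl u => h u | inr z => g (val z) end.
have fl u : f (glue_left u) = h u by [].
have fr v : f (glue_right v) = g v.
  by have [->|vy] := eqVneq v y; rewrite ?glue_right_base ?glue_right_sub.
have crossR u v : h u = g v -> v = y.
  by move=> e; apply: inj_g; rewrite -e (cross _ _ e).
exists f; split=> //.
  move=> w1 w2; case: (glueP w1) => [u1|v1 v1y]; case: (glueP w2) => [u2|v2 v2y]; rewrite ?fl ?fr.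
  - by move/inj_h->.
  - by move/crossR => e; rewrite e eqxx in v2y.
  - by move/esym/crossR => e; rewrite e eqxx in v1y.
  by move/inj_g->.
have crossE u v : v != y -> (glue_left u -- glue_right v) = E1 (h u) (g v) || E2 (h u) (g v).
  move=> vy; rewrite glue_cross_edge //.
  have -> : E1 (h u) (g v) = false.
    by apply/negP; rewrite sym1 => /s1[u' /crossR e]; rewrite e eqxx in vy.
  apply/idP/idP => [/andP[/eqP->]|E2uv]; first by rewrite hxy -e2.
  have [v' /esym ev] := s2 _ _ E2uv; have ux := cross _ _ ev.
  by rewrite ux eqxx e2 -hxy -ux.
move=> w1 w2; case: (glueP w1) => [u1|v1 v1y]; case: (glueP w2) => [u2|v2 v2y]; rewrite ?fl ?fr.
- rewrite glue_left_edge -e1; case e: (u1 -- u2) => //; apply/esym/negP => E2u.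
  have [v1 /esym ev1] := s2 _ _ E2u; have eu1 := cross _ _ ev1.
  have E2u' : E2 (h u2) (h u1) by rewrite sym2.
  have [v2 /esym ev2] := s2 _ _ E2u'; have eu2 := cross _ _ ev2.
  by move: E2u; rewrite eu1 eu2 hxy -e2 sedge_irrefl.
- exact: crossE.
- by rewrite sedge_sym crossE // sym1 sym2.
rewrite glue_right_edge -e2 orbC; case e: (v1 -- v2) => //; apply/esym/negP => E1v.
have [u1 /crossR ev1] := s1 _ _ E1v.
have E1v' : E1 (g v2) (g v1) by rewrite sym1.
have [u2 /crossR ev2] := s1 _ _ E1v'.
by move: E1v; rewrite ev1 ev2 -hxy -e1 sedge_irrefl.
Qed.

End Glue.

Local Notation bleft := (@glue_left (complete_graph 3) (complete_graph 3) ord0 ord0).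
Local Notation bright := (@glue_right (complete_graph 3) (complete_graph 3) ord0 ord0).

Lemma degree_center : degree (bleft ord0 : butterfly) = 4.
Proof.
rewrite /degree (_ : [set y | _] = ~: [set inl ord0]).
  by rewrite cardsC1 card_sum card_ord card_sig (eq_card (_ : _ =i predC1 ord0)) // cardC1 card_ord.
by apply/setP; case=> [b|[b nb]]; rewrite !inE //= /complete_edge eq_sym.
Qed.

Lemma degree_left (a : 'I_3) : a != ord0 -> degree (bleft a : butterfly) = 2.
Proof.
move=> na; rewrite /degree (_ : [set y | _] = inl @: (~: [set a])).
  by rewrite card_imset ?cardsC1 ?card_ord // => ? ? [].
apply/setP=> -[b|b]; rewrite inE /=; last first.
  by rewrite (negPf na); apply/esym/imsetP => -[].
apply/idP/imsetP => [ab|[b' + [->]]]; last by rewrite !inE eq_sym.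
by exists b => //; rewrite !inE eq_sym.
Qed.

Lemma degree_right (z : {a : 'I_3 | a != ord0}) : degree (inr z : butterfly) = 2.
Proof.
rewrite /degree (_ : [set y | _] = inl ord0 |: inr @: (~: [set z])).
  rewrite cardsU1 card_imset => [|? ? []//]; rewrite cardsC1 card_sig.
  rewrite (eq_card (_ : _ =i predC1 ord0)) // cardC1 card_ord.
  by case: imsetP => // -[].
apply/setP=> -[b|b]; rewrite !inE /=.
  have zN : complete_edge ord0 (val z) by rewrite /complete_edge eq_sym (valP z).
  by rewrite zN andbT; case: imsetP => [[]//|_]; rewrite orbF.
rewrite /complete_edge /=; apply/idP/imsetP => [ab|[b' + [->]]]; last by rewrite !inE eq_sym.
by exists b => //; rewrite !inE eq_sym.
Qed.

Lemma butterfly_centralE (u : butterfly) :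
  (u \in butterfly_central) = (u == bleft ord0).
Proof.
rewrite inE; case: u => [a|z]; last by rewrite degree_right.
have [->|na] := eqVneq a ord0; first by rewrite degree_center eqxx.
by rewrite degree_left // [RHS](inj_eq (@glue_left_inj _ _ _ _)) (negPf na).
Qed.

Definition clique_edge (V : finType) (T : {set V}) : rel V :=
  fun s t => [&& s != t, s \in T & t \in T].

Lemma clique_edge_sym (V : finType) (T : {set V}) : symmetric (clique_edge T).
Proof. by move=> s t; rewrite /clique_edge eq_sym [(s \in T) && _]andbC. Qed.

(** The images of two vertices are prescribed: vertex 0, where the triangles of a butterfly are
    identified, goes to the centre [c], and vertex 1, an extremal vertex of the butterfly, goes to
    [w], the future point of attachment. *)
Lemma triangle_embedding (V : finType) (T : {set V}) (c w : V) :
  #|T| = 3 -> c \in T -> w \in T -> c != w -> exists g : complete_graph 3 -> V,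
  [/\ injective g, g ord0 = c, g (inord 1) = w, forall i, g i \in T
    & (forall t, t \in T -> exists i, g i = t)
   /\ forall i j, (i -- j) = clique_edge T (g i) (g j)].
Proof.
move=> T3 cT wT cw; have [a aT] : exists a, a \in T :\ c :\ w.
  apply/card_gt0P; have := cardsD1 c T; have := cardsD1 w (T :\ c).
  by rewrite !inE eq_sym cw wT cT T3; lia.
move: aT; rewrite !inE => /and3P[aw ac aT].
pose s := [:: c; w; a]; have Us : uniq s by rewrite /= !inE negb_or cw eq_sym ac eq_sym aw.
pose g (i : complete_graph 3) := nth c s i.
have inj_g : injective g.
  by move=> i j /eqP; rewrite /g nth_uniq // => /eqP/val_inj.
have gT i : g i \in T.
  by apply: (allP (_ : all (mem T) s)); rewrite /= ?cT ?wT ?aT // mem_nth.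
exists g; split=> //; first by rewrite /g inordK.
split=> [t tT|i j]; last by rewrite /clique_edge (inj_eq inj_g) !gT !andbT.
suff : t \in s.
  by rewrite -index_mem => lt_t; exists (Ordinal lt_t); rewrite /g nth_index // -index_mem.
have : T \subset [set u in s].
  rewrite -(_ : [set u in s] = T) //; apply/eqP; rewrite eqEcard cardsE (card_uniqP Us) T3 andbT.
  by apply/subsetP=> u; rewrite !inE => /or3P[]/eqP->.
by move/subsetP/(_ t tT); rewrite inE.
Qed.

Lemma butterfly_embedding (V : finType) (T1 T2 : {set V}) (c w : V) :
  #|T1| = 3 -> #|T2| = 3 -> T1 :&: T2 = [set c] -> w \in T1 -> c != w ->
  exists g : butterfly -> V, [/\ injective g,
    forall u v, (u -- v) = clique_edge T1 (g u) (g v) || clique_edge T2 (g u) (g v),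
    forall z, z \in T1 :|: T2 <-> exists u, g u = z,
    forall u, (u \in butterfly_central) = (g u == c)
  & exists2 x, x \in butterfly_extremal & g x = w].
Proof.
move=> T13 T23 T12 wT1 cw; have /setIP[cT1 cT2] : c \in T1 :&: T2 by rewrite T12 set11.
have [w2 w2T2 cw2] : exists2 w2, w2 \in T2 & c != w2.
  have /card_gt0P[w2] : 0 < #|T2 :\ c| by have := cardsD1 c T2; rewrite cT2 T23; lia.
  by rewrite !inE eq_sym => /andP[]; exists w2.
have [g1 [inj1 g10 g11 in1 [sur1 e1]]] := triangle_embedding T13 cT1 wT1 cw.
have [g2 [inj2 g20 _ in2 [sur2 e2]]] := triangle_embedding T23 cT2 w2T2 cw2.
have [|||f [inj_f fl fr ef]] := glue_embedding (@clique_edge_sym _ T1) (@clique_edge_sym _ T2)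
    inj1 inj2 (etrans g10 (esym g20)) _ e1 e2.
- move=> u v e; apply: inj1; rewrite g10; apply/set1P.
  by rewrite -T12 inE in1 e in2.
- by move=> s t /and3P[_ /sur1].
- by move=> s t /and3P[_ /sur2].
exists f; split=> //.
- move=> z; split=> [/setUP[/sur1[i <-]|/sur2[i <-]]|[u <-]].
  + by exists (bleft i).
  + by exists (bright i).
  by case: (glueP u) => [i|i _]; rewrite ?fl ?fr inE ?in1 ?in2 ?orbT.
- by move=> u; rewrite butterfly_centralE -(inj_eq inj_f) fl g10.
exists (bleft (inord 1)); last by rewrite fl.
by rewrite inE degree_left // -val_eqE /= inordK.
Qed.

(** * Assembling the butterflies *)

Section Growth.
Variables (G : sgraph) (I : finType) (D : I * bool -> {set G}) (c : I -> G).
Hypothesis conG : connected G.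
Hypothesis cycD : forall p, is_support (D p).
Hypothesis triD : forall p, #|D p| = 3.
Hypothesis hypD : hyperforest D setT.
Hypothesis meetD : forall p q, p != q -> #|D p :&: D q| <= 1.
Hypothesis centerD : forall i j b, (c i \in D (j, b)) = (i == j).
Hypothesis coverD : forall a b : G, a -- b -> exists p, (a \in D p) && (b \in D p).

Let B i := D (i, true) :|: D (i, false).
Let U (J : {set I}) := \bigcup_(i in J) B i.
Let E (J : {set I}) : rel G := fun s t => [exists i in J, exists b, clique_edge (D (i, b)) s t].

Implicit Types (i : I) (J : {set I}) (s t : G).

Lemma wing_meet i : D (i, true) :&: D (i, false) = [set c i].
Proof.
apply/esym/eqP; rewrite eqEcard cards1 meetD ?xpair_eqE ?andbF // andbT sub1set inE.
by rewrite !centerD eqxx.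
Qed.

Lemma card_butterfly i : #|B i| = 5.
Proof. by have := cardsUI (D (i, true)) (D (i, false)); rewrite wing_meet cards1 !triD -/(B i); lia. Qed.

Lemma center_union i J : (c i \in U J) = (i \in J).
Proof.
apply/bigcupP/idP => [[j jJ]|iJ]; last by exists i; rewrite // inE centerD eqxx.
by rewrite inE !centerD orbb => /eqP->.
Qed.

(** The 2m wings of m butterflies are triangles, so the inequality reads 6m + 1 <= |U J| + 2m. *)
Lemma card_butterflies J : J != set0 -> (4 * #|J|).+1 <= #|U J|.
Proof.
move=> Jn0; have := hypD (subsetT (setX J setT)).
have -> : \bigcup_(p in setX J setT) D p = U J.
  apply/setP=> x; apply/bigcupP/bigcupP=> [[[i b]]|[i iJ]].
    by case/setXP=> iJ _ xD; exists i => //; rewrite inE; case: b xD => ->; rewrite ?orbT.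
  by rewrite inE => /orP[] xD; [exists (i, true) | exists (i, false)]; rewrite // in_setX iJ inE.
rewrite (eq_bigr (fun=> 3)) // sum_nat_const -card_gt0 cardsX cardsT card_bool.
by move: Jn0; rewrite -card_gt0; lia.
Qed.

Lemma clique_edge_sub s t i b J : i \in J -> clique_edge (D (i, b)) s t -> E J s t.
Proof. by move=> iJ st; apply/existsP; exists i; rewrite iJ; apply/existsP; exists b. Qed.

Lemma E_sym J : symmetric (E J).
Proof.
move=> s t; apply: eq_existsb => i; congr (_ && _); apply: eq_existsb => b.
exact: clique_edge_sym.
Qed.

Lemma E_in J s t : E J s t -> s \in U J.
Proof.
case/existsP=> i /andP[iJ /existsP[b /and3P[_ sD _]]]; apply/bigcupP; exists i => //.
by rewrite inE; case: b sD => ->; rewrite ?orbT.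
Qed.

Lemma E_setU1 i J s t : E (i |: J) s t =
  E J s t || (clique_edge (D (i, true)) s t || clique_edge (D (i, false)) s t).
Proof.
apply/existsP/idP => [[j /andP[+ /existsP[b st]]]|].
  case/setU1P=> [ej|jJ]; last by rewrite (clique_edge_sub jJ st).
  by rewrite -ej; case: b st => ->; rewrite ?orbT.
case/orP=> [/existsP[j /andP[jJ st]]|st]; first by exists j; rewrite inE jJ orbT.
by exists i; rewrite setU11; apply/existsP; case/orP: st => st; [exists true | exists false].
Qed.

Lemma E_set0 s t : E set0 s t = false.
Proof. by apply/existsP=> -[i]; rewrite inE. Qed.

(** One direction is [coverD]. For the other, a cycle on three vertices uses every pair of them as
    an edge. *)
Lemma edgeE s t : (s -- t) = E setT s t.
Proof.
apply/idP/idP => [st|/existsP[i /andP[_ /existsP[b /and3P[sNt sD tD]]]]].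
  have [[i b] /andP[sD tD]] := coverD st; apply: (@clique_edge_sub _ _ i b); rewrite ?inE //.
  by rewrite /clique_edge sD tD !andbT; apply: contraTneq st => ->; rewrite sedge_irrefl.
have [d cyd eqd] := cycD (i, b).
have /(cycle_edgeP cyd)[x [y [exy _ _ xy]]] : [set s; t] \in cycle_edges d.
  rewrite triangle_edges ?eqd // inE cards2 sNt andbT.
  by apply/subsetP=> z; rewrite !inE => /orP[]/eqP->.
have := set21 s t; have := set22 s t; rewrite exy !inE.
by move=> /orP[]/eqP et /orP[]/eqP es; rewrite et es ?eqxx // in sNt *; rewrite sedge_sym.
Qed.

Lemma union_setT : 0 < #|I| -> U setT = setT.
Proof.
case/card_gt0P=> i _; apply/setP=> v; rewrite inE; apply: contraT => vNU.
have ciU : c i \in U setT by rewrite center_union inE.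
have [a [b [_ bNU ab]]] := crossing_edge (conG.2 (c i) v) ciU vNU.
have ba : E setT b a by rewrite -edgeE sedge_sym.
by rewrite (E_in ba) in bNU.
Qed.

(** By connectedness some edge leaves [U J]. The wing that contains it belongs to a butterfly
    outside [J], since its far end is not covered. *)
Lemma growth_step J : J != set0 -> J != setT -> exists i w, i \notin J /\ w \in B i :&: U J.
Proof.
move=> Jn0 JnT; have [j jJ] := set0Pn _ Jn0.
have [i iNJ] : exists i, i \notin J.
  apply/existsP; rewrite -negb_forall; apply: contra JnT => /forallP inJ.
  by apply/eqP/setP=> i; rewrite inE; apply: inJ.
have cjU : c j \in U J by rewrite center_union.
have [a [b [aU bNU ab]]] := crossing_edge (conG.2 (c j) (c i)) cjU (negbT (etrans (center_union i J) (negPf iNJ))).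
have [[i' b'] /andP[aD bD]] := coverD ab.
have inB z : z \in D (i', b') -> z \in B i' by rewrite inE; case: (b') => ->; rewrite ?orbT.
exists i', a; split; last by rewrite inE inB.
by apply: contra bNU => i'J; apply/bigcupP; exists i'; rewrite ?inB.
Qed.

(** Edges are compared with [E J], which spares a proof that the copy is induced in [G]; [edgeE]
    closes the gap when [J] is everything. The clause on centres allows the next butterfly to be
    attached at a non-central vertex. *)
Definition grown (J : {set I}) := exists (M : marked_graph) (h : M -> G),
  [/\ butterfly_construction #|J| M, injective h,
      forall z, z \in U J <-> exists u, h u = z,
      forall u v, (u -- v) = E J (h u) (h v)
    & forall u, (u \in central M) = (h u \in c @: J)].

Lemma wings_embedding i w : w \in B i -> c i != w -> exists g : butterfly -> G,
  [/\ injective g,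
    forall u v, (u -- v) = clique_edge (D (i, true)) (g u) (g v) || clique_edge (D (i, false)) (g u) (g v),
    forall z, z \in B i <-> exists u, g u = z,
    forall u, (u \in butterfly_central) = (g u == c i)
  & exists2 x, x \in butterfly_extremal & g x = w].
Proof.
case/setUP=> wD cw; first exact: (butterfly_embedding (triD _) (triD _) (wing_meet i) wD cw).
have meet' : D (i, false) :&: D (i, true) = [set c i] by rewrite setIC wing_meet.
have [g [inj e im ctr ext]] := butterfly_embedding (triD _) (triD _) meet' wD cw.
by exists g; split=> //; [move=> u v; rewrite e orbC | move=> z; rewrite /B setUC].
Qed.

Lemma grown_one i : grown [set i].
Proof.
have [w wB cw] : exists2 w, w \in B i & c i != w.
  have /card_gt0P[w] : 0 < #|B i :\ c i|.
    by have := cardsD1 (c i) (B i); rewrite card_butterfly; case: (_ \in _); lia.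
  by rewrite !inE eq_sym => /andP[? ?]; exists w; rewrite ?inE.
have [g [inj e im ctr _]] := wings_embedding wB cw.
exists marked_butterfly, g; split=> //.
- by rewrite cards1; constructor.
- by rewrite /U big_set1.
- by move=> u v; rewrite e -[[set i]]setU0 E_setU1 E_set0.
by move=> u; rewrite imset_set1 inE; apply: ctr.
Qed.

(** The upper bound 4m + 1 makes [card_butterflies] tight. The new union has at least 4(m + 1) + 1
    vertices and the new butterfly has 5, so they leave room for only one common vertex, [w]. *)
Lemma grown_attach J i w : J != set0 -> #|U J| <= (4 * #|J|).+1 -> i \notin J ->
  w \in B i :&: U J -> grown J -> grown (i |: J) /\ #|U (i |: J)| <= (4 * #|i |: J|).+1.
Proof.
move=> Jn0 tightJ iNJ wBU [M [h [conM inj_h im_h e_h ctr_h]]].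
have UiJ : U (i |: J) = B i :|: U J by rewrite /U big_setU1.
have cardBU : #|B i :&: U J| <= 1 /\ #|U (i |: J)| <= (4 * #|i |: J|).+1.
  have : i |: J != set0 by apply/set0Pn; exists i; rewrite setU11.
  move/card_butterflies; have := cardsUI (B i) (U J).
  have : 0 < #|B i :&: U J| by apply/card_gt0P; exists w.
  by rewrite -UiJ card_butterfly cardsU1 iNJ; move: tightJ; lia.
split; last by case: cardBU.
have {cardBU} [/card_le1_eqP meetBU _] := cardBU.
have uniqw z : z \in B i -> z \in U J -> z = w.
  by move=> zB zU; apply: meetBU; rewrite // inE zB.
have /setIP[wB wU] := wBU.
have cw : c i != w by apply: contraNneq iNJ => ciw; rewrite -center_union ciw.
have [g [inj_g e_g im_g ctr_g [x xext gx]]] := wings_embedding wB cw.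
have [v hv] : exists v, h v = w by apply/im_h.
have hU u : h u \in U J by apply/im_h; exists u.
have gB u : g u \in B i by apply/im_g; exists u.
(* A centre lies in the wings of its own butterfly only, and [w] lies in [B i] with [i] outside
   [J]. *)
have vNc : v \notin central M.
  rewrite ctr_h hv; apply/imsetP=> -[j jJ wj]; move: wB; rewrite wj inE !centerD orbb.
  by move/eqP=> ji; rewrite -ji jJ in iNJ.
pose E2 := fun s t => clique_edge (D (i, true)) s t || clique_edge (D (i, false)) s t.
have E2_sym : symmetric E2 by move=> s t; rewrite /E2 !(clique_edge_sym _ s).
have [|||f [inj_f fl fr ef]] := glue_embedding (@E_sym J) E2_sym inj_h inj_g
    (etrans hv (esym gx)) _ e_h e_g.
- by move=> u u' e; apply: inj_h; rewrite hv; apply: uniqw => //; rewrite e.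
- by move=> s t /E_in/im_h.
- by move=> s t /orP[]/and3P[_ sD _]; apply/im_g; rewrite inE sD ?orbT.
exists (attach_butterfly v x), f; split=> //.
- by rewrite cardsU1 iNJ; apply: construction_step.
- move=> z; rewrite UiJ; split=> [/setUP[/im_g[u <-]|/im_h[u <-]]|[u <-]].
  + by exists (glue_right v x u).
  + by exists (glue_left v x u).
  by case: (glueP u) => [u'|u' _]; rewrite ?fl ?fr inE ?hU ?gB ?orbT.
- by move=> u1 u2; rewrite E_setU1; apply: ef.
move=> u; rewrite imsetU1 in_setU1; case: (glueP u) => [u'|u' u'x].
  rewrite fl inE /= ctr_h; case: eqP => // eh.
  by have := hU u'; rewrite eh center_union (negPf iNJ).
rewrite fr inE glue_right_sub /= ctr_g; case: eqP => // /eqP gc; apply/esym/imsetP=> -[j jJ gj].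
have := gB u'; rewrite gj inE !centerD orbb => /eqP ji.
by rewrite -ji jJ in iNJ.
Qed.

Lemma connected_butterflies : 0 < #|I| -> butterfly_cactus #|I| G.
Proof.
move=> I0; have grow n : 0 < n <= #|I| ->
    exists J, [/\ #|J| = n, #|U J| <= (4 * #|J|).+1 & grown J].
  elim: n => // -[_ _|n IHn /andP[_ ltn]].
    have [i _] := card_gt0P I0; exists [set i]; split; rewrite ?cards1 //; last exact: grown_one.
    by rewrite /U big_set1 card_butterfly.
  have [|J [cardJ tightJ grJ]] := IHn; first exact: ltnW.
  have Jn0 : J != set0 by rewrite -card_gt0 cardJ.
  have [|i [w [iNJ wBU]]] := @growth_step J Jn0.
    by apply: contraTneq ltn => JT; rewrite -cardJ JT cardsT ltnn.
  have [gr tight] := grown_attach Jn0 tightJ iNJ wBU grJ.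
  by exists (i |: J); split=> //; rewrite cardsU1 iNJ cardJ.
have [|J [cardJ _ [M [h [conM inj_h im_h e_h _]]]]] := grow #|I|; first by rewrite I0 leqnn.
have JT : J = setT by apply/eqP; rewrite eqEcard subsetT cardsT cardJ leqnn.
rewrite JT in im_h e_h.
have [z|f fK] := @fin_all_exists G (fun=> M : Type) (fun z u => h u = z).
  by apply/im_h; rewrite union_setT // inE.
exists M; first by rewrite -cardJ.
exists f; first by exists h => // u; apply: inj_h.
by move=> s t; rewrite e_h !fK -edgeE.
Qed.

End Growth.

Theorem connected_cactus_obstruction (k : nat) (G : sgraph) :
  connected G -> obs (apex k sub_unicyclic) G -> cactus G -> butterfly_cactus k.+1 G.
Proof.
move=> conG obsG /cactus_cycles cycG.
have [I [D [c [cardI cycD hypD meetD centerD]]]] := obs_butterflies conG obsG cycG.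
rewrite -cardI; apply: (connected_butterflies conG cycD _ hypD meetD centerD).
- exact: (obs_triangle obsG cardI cycD hypD meetD centerD).
- exact: (obs_edge_covered obsG cardI cycD hypD centerD).
by rewrite cardI.
Qed.

(** * Blocks under embeddings and gluing *)

Lemma homo_connect (G H : sgraph) (f : G -> H) : {homo f : u v / u -- v} ->
  forall u v, connect (@sedge G) u v -> connect (@sedge H) (f u) (f v).
Proof.
move=> hom u v /connectP[p]; elim: p u => [|w p IHp] u /= => [_ ->//|/andP[uw pw] ev].
exact: connect_trans (connect1 (hom _ _ uw)) (IHp _ pw ev).
Qed.

Lemma nonseparableE (G : sgraph) (B : {set G}) : nonseparable (induced B) ->
  [/\ B != set0, connected_in B & forall z, z \in B -> connected_in (B :\ z)].
Proof.
move=> [[/card_gt0P[u0 _] con] nocut].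
have lift (K : sgraph) (f : K -> G) (A : {set G}) : {homo f : u v / u -- v} ->
    (forall u, f u \in A) -> (forall u v : K, connect (@sedge K) u v) ->
    forall u v, connect (restricted_edge A) (f u) (f v).
  move=> hom fA conK u v; have /connectP[p] := conK u v.
  elim: p u => [|w p IHp] u /= => [_ ->//|/andP[uw pw] ev].
  by apply: connect_trans (IHp _ pw ev); apply: connect1; rewrite /restricted_edge /= hom ?fA.
have conB : connected_in B.
  move=> x y xB yB; apply: (lift (induced B) val _ _ _ _ (exist _ x xB) (exist _ y yB)) => //.
  exact: valP.
split=> // [|z zB]; first by apply/set0Pn; exists (val u0); apply: valP.
pose z' : induced B := exist _ z zB.
have conD : forall u v : delete [set z'], connect (@sedge _) u v.
  move=> u v; apply: contraT => /n_components_gt1 gt1.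
  case: (nocut z'); rewrite /cutvertex; apply: leq_ltn_trans gt1.
  exact: n_components_le1.
have inD x : x \in B :\ z -> exists u : delete [set z'], val (val u) = x.
  case/setD1P=> xz xB; have xN : (exist _ x xB : induced B) \in ~: [set z'].
    by rewrite !inE -(inj_eq val_inj).
  by exists (exist _ (exist _ x xB : induced B) xN : delete [set z']).
move=> x y /inD[u <-] /inD[v <-].
apply: (lift (delete [set z']) (fun w => val (val w))) => // w.
rewrite !inE (valP (val w)) andbT; have := valP w; rewrite !inE.
by rewrite -(inj_eq val_inj).
Qed.

Section Embedding.
Variables (K L : sgraph) (f : K -> L).
Hypothesis f_inj : injective f.
Hypothesis f_mono : {mono f : u v / u -- v}.

Implicit Types A B : {set K}.

Lemma restricted_embed A u v : connect (restricted_edge (f @: A)) (f u) (f v) ->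
  connect (restricted_edge A) u v.
Proof.
case/connectP=> p; elim: p u => [|x p IHp] u /= => [_ /f_inj->//|].
case/andP=> /and3P[ux uA /imsetP[w wA ew]]; rewrite ew in ux * => pw ev.
apply: connect_trans (IHp _ pw ev); apply: connect1.
by rewrite /restricted_edge /= -f_mono ux wA andbT -(mem_imset _ _ f_inj).
Qed.

Lemma connected_in_embed A : connected_in (f @: A) <-> connected_in A.
Proof.
split=> con => [x y xA yA|_ _ /imsetP[x xA ->] /imsetP[y yA ->]].
  by apply/restricted_embed/con; apply: imset_f.
have /connectP[p] := con x y xA yA; elim: p x xA => [|z p IHp] x xA /= => [_ ->//|].
case/andP=> /and3P[xz _ zA] pz ey; apply: connect_trans (IHp _ zA pz ey).
by apply: connect1; rewrite /restricted_edge /= f_mono xz !imset_f.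
Qed.

Lemma embed_setD1 A x : f @: A :\ f x = f @: (A :\ x).
Proof.
apply/setP=> y; apply/setD1P/imsetP => [[yx /imsetP[z zA ez]]|[z /setD1P[zx zA] ->]].
  by exists z; rewrite // !inE zA andbT; apply: contraNneq yx => <-; rewrite ez.
by rewrite (inj_eq f_inj) imset_f.
Qed.

Lemma nonseparable_embed B : nonseparable (induced (f @: B)) <-> nonseparable (induced B).
Proof.
split=> /nonseparableE[/set0Pn[x xB] con conD]; apply: nonseparableI.
- by apply/set0Pn; case/imsetP: xB => y yB _; exists y.
- exact/connected_in_embed.
- by move=> z zB; apply/connected_in_embed; rewrite -embed_setD1; apply: conD; apply: imset_f.
- by apply/set0Pn; exists (f x); apply: imset_f.
- exact/connected_in_embed.
by move=> _ /imsetP[z zB ->]; rewrite embed_setD1; apply/connected_in_embed/conD.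
Qed.

Lemma block_embed B : block (f @: B) -> block B.
Proof.
move=> [nsB maxB]; split=> [|C sBC nsC]; first exact/nonseparable_embed.
by apply: (imset_inj f_inj); apply: maxB; [apply: imsetS | apply/nonseparable_embed].
Qed.

Lemma induced_embed_iso B : graph_iso (induced (f @: B)) (induced B).
Proof.
have [w|g gP] := @fin_all_exists (induced (f @: B)) (fun=> induced B : Type)
    (fun w u => f (val u) = val w).
  by have /imsetP[x xB ->] := valP w; exists (exist _ x xB).
pose h (u : induced B) : induced (f @: B) := exist _ (f (val u)) (imset_f f (valP u)).
exists g; last by move=> u v; rewrite /= /induced_edge -f_mono !gP.
exists h => [w|u]; first by apply: val_inj; rewrite /= gP.
by apply/val_inj/f_inj; rewrite gP.
Qed.

End Embedding.

Lemma graph_iso_trans (G H K : sgraph) : graph_iso G H -> graph_iso H K -> graph_iso G K.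
Proof.
move=> [f bf fm] [g bg gm]; exists (g \o f); first exact: bij_comp.
by move=> x y; rewrite /= gm fm.
Qed.

Lemma graph_iso_sym (G H : sgraph) : graph_iso G H -> graph_iso H G.
Proof.
move=> [f [g fK gK] fm]; exists g; first by exists f.
by move=> x y; rewrite -fm !gK.
Qed.

(** A block of [L] inside an induced copy of [K] comes from a block of [K]: a larger nonseparable
    set in [K] would be one in [L]. This serves both gluings and isomorphisms. *)
Lemma cactus_cover (L : sgraph) :
  (forall B : {set L}, nonseparable (induced B) -> exists (K : sgraph) (f : K -> L) (A : {set K}),
     [/\ cactus K, injective f, {mono f : u v / u -- v} & B = f @: A]) -> cactus L.
Proof.
move=> cov B bB; have [K [f [A [cacK inj mono eB]]]] := cov B bB.1; subst B.
have iso := induced_embed_iso inj mono A.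
case: (cacK A (block_embed inj mono bB)) => [isoA|isoA|[n isoA]].
- by constructor 1; apply: graph_iso_trans isoA.
- by constructor 2; apply: graph_iso_trans isoA.
by constructor 3; exists n; apply: graph_iso_trans isoA.
Qed.

Lemma imset_preim (V W : finType) (f : V -> W) (B : {set W}) :
  (forall w, w \in B -> exists v, f v = w) -> B = f @: (f @^-1: B).
Proof.
move=> sur; apply/setP=> w; apply/idP/imsetP => [wB|[v + ->]]; last by rewrite inE.
by have [v ev] := sur w wB; exists v; rewrite // inE ev.
Qed.

Section GlueSides.
Variables (G H : sgraph) (x : G) (y : H).
Let K := glue x y.
Let base : K := glue_left x y x.

Lemma glue_one_side (A : {set K}) : connected_in A -> base \notin A ->
  (forall w, w \in A -> exists u, glue_left x y u = w) \/
  (forall w, w \in A -> exists v, glue_right x y v = w).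
Proof.
move=> con baseN; pose side (w : K) := if w is inl _ then true else false.
have sideR z : side (inr z) = false by [].
have same u v : u \in A -> v \in A -> side u = side v.
  move=> uA vA; have /connectP[p] := con u v uA vA.
  elim: p u {uA} => [|w p IHp] u /= => [_ ->//|/andP[/and3P[uw uA wA] pw] ev].
  rewrite -(IHp w pw ev); case: u uw uA => [u|u]; case: w wA {pw ev} => [w|w] //= wA.
    by case/andP=> /eqP eu _ uA; rewrite eu in uA; case/negP: baseN.
  by case/andP=> /eqP ew _ _; rewrite ew in wA; case/negP: baseN.
have [[w0 [w0A s0]]|none] := classic (exists w, w \in A /\ side w); [left|right].
  by move=> w wA; have := same w0 w w0A wA; rewrite s0; case: w {wA} => // u _; exists u.
move=> [u|z] zA; first by case: none; exists (inl u).
by exists (val z); apply: glue_right_val.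
Qed.

(** The common vertex lies on both sides, so it can be put back. The lemma applies to nonseparable
    sets and to cycles, as both stay connected without that vertex. *)
Lemma glue_one_side_base (A : {set K}) : connected_in (A :\ base) ->
  (forall w, w \in A -> exists u, glue_left x y u = w) \/
  (forall w, w \in A -> exists v, glue_right x y v = w).
Proof.
move/glue_one_side; rewrite !inE eqxx => /(_ isT)[side|side]; [left|right] => w wA;
  have [->|wN] := eqVneq w base; try (by apply: side; rewrite !inE wN).
  by exists x.
by exists y; apply: glue_right_base.
Qed.

Lemma glue_cactus : cactus G -> cactus H -> cactus K.
Proof.
move=> cacG cacH; apply: cactus_cover => B /nonseparableE[_ con conD].
have : connected_in (B :\ base).
  have [/conD//|bN] := boolP (base \in B).
  by rewrite (_ : B :\ base = B) //; apply/setDidPl; rewrite disjoint_sym disjoints1.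
case/glue_one_side_base=> side.
  exists G, (glue_left x y), (glue_left x y @^-1: B); split=> //.
    exact: glue_left_inj.
  exact: imset_preim.
exists H, (glue_right x y), (glue_right x y @^-1: B); split=> //.
- exact: glue_right_inj.
- exact: glue_right_edge.
exact: imset_preim.
Qed.

Lemma glue_connected : connected G -> connected H -> connected K.
Proof.
move=> [_ conG] [_ conH]; split; first by apply/card_gt0P; exists base.
have homL : {homo glue_left x y : u v / u -- v} by [].
have homR : {homo glue_right x y : u v / u -- v} by move=> u v; rewrite glue_right_edge.
have toB w : connect (@sedge K) w base.
  case: (glueP w) => [u|v _]; first exact: homo_connect homL _ _ (conG u x).
  by rewrite /base -glue_right_base; apply: homo_connect homR _ _ (conH v y).
move=> u v; apply: connect_trans (toB u) _.
by rewrite sedge_connect_sym toB.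
Qed.

Lemma support_embed (L M : sgraph) (f : L -> M) (T : {set L}) : injective f ->
  {mono f : u v / u -- v} -> is_support T <-> is_support (f @: T).
Proof.
move=> inj mono; split=> [[c cyc <-]|[c cyc eqT]].
  exists (map f c); first by apply: map_cycle_hom => // u v _ _; [apply: inj | rewrite mono].
  by apply/setP=> z; rewrite inE; apply/mapP/imsetP=> -[u uc ->]; exists u; rewrite // inE in uc *.
have [d ed] : exists d, c = map f d.
  have : {subset c <= f @: T} by move=> z zc; rewrite -eqT inE.
  elim: c {cyc eqT} => [|z c IHc] sub; first by exists [::].
  have [|d ->] := IHc; first by move=> u uc; apply: sub; rewrite inE uc orbT.
  have /imsetP[u _ ->] : z \in f @: T by apply: sub; rewrite mem_head.
  by exists (u :: d).
exists d; first by apply: (map_cycleV inj) => //; rewrite -ed.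
apply: (imset_inj inj); rewrite -eqT ed; apply/setP=> z; rewrite [RHS]inE.
by apply/imsetP/mapP=> -[u ud ->]; exists u; rewrite // inE in ud *.
Qed.

Lemma glue_support (T : {set K}) : is_support T ->
  (exists2 S, is_support S & T = glue_left x y @: S) \/
  (exists2 S, is_support S & T = glue_right x y @: S).
Proof.
move=> supT; have [c cyc eqT] := supT.
have := cycle_connected_inD1 (z := base) cyc; rewrite eqT.
case/glue_one_side_base=> /imset_preim eT; [left|right]; rewrite eT in supT.
  exists (glue_left x y @^-1: T) => //.
  exact: (support_embed _ (@glue_left_inj _ _ x y) _).2 supT.
exists (glue_right x y @^-1: T) => //.
exact: (support_embed _ (@glue_right_inj _ _ x y) (@glue_right_edge _ _ x y)).2 supT.
Qed.

End GlueSides.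

(** * Butterfly cacti are obstructions *)

(** The invariant of the construction. [system_central] bounds by two the triangles through a
    centre. [system_hitting] asks for uniqueness because this tells, in a gluing, that a small
    hitting set of one side avoids the non-central vertex being identified. *)
Record triangle_system (k : nat) (M : marked_graph) : Prop := TriangleSystem {
  card_central : #|central M| = k;
  system_triangle : forall T : {set M}, is_support T ->
    #|T| = 3 /\ exists c, T :&: central M = [set c];
  system_edge : forall x y : M, x -- y -> exists T, [/\ is_support T, x \in T & y \in T];
  system_central : forall (T1 T2 T3 : {set M}) c,
    is_support T1 -> is_support T2 -> is_support T3 -> c \in central M ->
    c \in T1 -> c \in T2 -> c \in T3 -> [\/ T1 = T2, T1 = T3 | T2 = T3];
  system_hitting : forall X : {set M}, #|X| <= k ->
    (forall T, is_support T -> ~~ [disjoint T & X]) -> X = central M }.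

Lemma K3_support (T : {set complete_graph 3}) : is_support T <-> T = setT.
Proof.
split=> [/is_support_gt2 T3|->].
  by apply/eqP; rewrite eqEcard subsetT cardsT card_ord.
exists [:: ord0; inord 1; inord 2 : complete_graph 3].
  split=> //; rewrite /ucycle /= /complete_edge !inE -!val_eqE /= !inordK //.
apply/eqP; rewrite eqEcard subsetT cardsT card_ord cardsE.
suff /card_uniqP-> : uniq [:: ord0; inord 1; inord 2 : 'I_3] by [].
by rewrite /= !inE -!val_eqE /= !inordK.
Qed.

Lemma butterfly_support (T : {set butterfly}) :
  is_support T <-> T = bleft @: setT \/ T = bright @: setT.
Proof.
split=> [/glue_support[[S /K3_support-> ->]|[S /K3_support-> ->]]|[->|->]]; [by left|by right| |].
  have supT := (K3_support setT).2 erefl.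
  exact: (support_embed _ (@glue_left_inj _ _ _ _) (@glue_left_edge _ _ _ _)).1 supT.
have supT := (K3_support setT).2 erefl.
exact: (support_embed _ (@glue_right_inj _ _ _ _) (@glue_right_edge _ _ _ _)).1 supT.
Qed.

Lemma butterfly_wing_meet :
  (bleft @: setT : {set butterfly}) :&: bright @: setT = [set bleft ord0].
Proof.
apply/setP=> z; rewrite inE in_set1; apply/andP/eqP => [[/imsetP[a _ ->] /imsetP[b _]]|->].
  by case/glue_left_right=> ->.
by rewrite -{2}glue_right_base !imset_f ?inE.
Qed.

Lemma butterfly_centralT : butterfly_central = [set bleft ord0].
Proof. by apply/setP=> u; rewrite butterfly_centralE inE. Qed.

Lemma triangle_system_butterfly : triangle_system 1 marked_butterfly.
Proof.
have inL a : bleft a \in bleft @: setT by rewrite imset_f.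
have inR a : bright a \in bright @: setT by rewrite imset_f.
have supL : is_support (bleft @: setT : {set butterfly}) by apply/butterfly_support; left.
have supR : is_support (bright @: setT : {set butterfly}) by apply/butterfly_support; right.
have cardL : #|(bleft @: setT : {set butterfly})| = 3.
  by rewrite card_imset ?cardsT ?card_ord //; apply: glue_left_inj.
have cardR : #|(bright @: setT : {set butterfly})| = 3.
  by rewrite card_imset ?cardsT ?card_ord //; apply: glue_right_inj.
have cL : bleft ord0 \in bleft @: setT by [].
have cR : bleft ord0 \in bright @: setT by rewrite -glue_right_base.
have edges (u w : butterfly) : u -- w -> exists T : {set butterfly},
    [/\ is_support T, u \in T & w \in T].
  case: (glueP u) => [a|a na]; case: (glueP w) => [b|b nb] uw.
  - by exists (bleft @: setT).
  - move: uw; rewrite glue_cross_edge // => /andP[/eqP-> _].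
    by exists (bright @: setT).
  - move: uw; rewrite sedge_sym glue_cross_edge // => /andP[/eqP-> _].
    by exists (bright @: setT).
  by exists (bright @: setT).
split.
- by rewrite /= butterfly_centralT cards1.
- move=> T supT; split.
    by case/butterfly_support: supT => ->; [exact: cardL | exact: cardR].
  exists (bleft ord0 : marked_butterfly); rewrite /= butterfly_centralT; apply/setIidPr; rewrite sub1set.
  by case/butterfly_support: supT => ->.
- exact: edges.
- move=> T1 T2 T3 c /butterfly_support s1 /butterfly_support s2 /butterfly_support s3 _ _ _ _.
  case: s1 => ->; case: s2 => ->; case: s3 => ->; by [constructor 1|constructor 2|constructor 3].
move=> X leX hit; have hitm (T : {set butterfly}) : is_support T -> exists2 z, z \in T & z \in X.
  by move/hit; rewrite -setI_eq0 => /set0Pn[z /setIP[]]; exists z.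
have [z1 z1L z1X] := hitm _ supL; have [z2 z2R z2X] := hitm _ supR.
have z12 : z1 = z2 by move/card_le1_eqP: leX; apply.
have : z1 \in [set bleft ord0] by rewrite -butterfly_wing_meet inE z1L z12.
rewrite inE => /eqP ez; rewrite /= butterfly_centralT; apply/setP=> u; rewrite inE.
apply/idP/eqP => [uX|->]; last by rewrite -ez.
by rewrite -ez; move/card_le1_eqP: leX; apply.
Qed.

(** Every cycle lies on one side and the identified vertex is no centre, so the local clauses are
    inherited from the side concerned. Only the hitting sets have to be split between the two
    sides. *)
Lemma triangle_system_glue (k1 k2 : nat) (M1 M2 : marked_graph) (v : M1) (x : M2)
    (C : {set glue v x}) :
  triangle_system k1 M1 -> triangle_system k2 M2 ->
  v \notin central M1 -> x \notin central M2 ->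
  C = glue_left v x @: central M1 :|: glue_right v x @: central M2 ->
  triangle_system (k1 + k2) (MarkedGraph C).
Proof.
move=> S1 S2 vN xN eC.
pose gl := glue_left v x; pose gr := glue_right v x.
have injl : injective gl by apply: glue_left_inj.
have injr : injective gr by apply: glue_right_inj.
have supl (S : {set M1}) : is_support S -> is_support (gl @: S).
  exact: (support_embed _ injl (@glue_left_edge _ _ _ _)).1.
have supr (S : {set M2}) : is_support S -> is_support (gr @: S).
  exact: (support_embed _ injr (@glue_right_edge _ _ _ _)).1.
have Cl u : (gl u \in C) = (u \in central M1).
  rewrite eC inE mem_imset //; case: imsetP => [[w wC /glue_left_right[_ ew]]|_]; last by rewrite orbF.
  by rewrite ew (negPf xN) in wC.
have Cr w : (gr w \in C) = (w \in central M2).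
  rewrite eC inE orbC mem_imset //; case: imsetP => [[u uC /esym/glue_left_right[eu _]]|_]; last by rewrite orbF.
  by rewrite eu (negPf vN) in uC.
have onl T c : is_support T -> c \in central M1 -> gl c \in T ->
    exists S, [/\ is_support S, c \in S & T = gl @: S].
  move=> /glue_support[[S supS ->]|[S supS ->]] cC.
    by rewrite mem_imset // => cS; exists S.
  by case/imsetP=> w _ /glue_left_right[ec _]; rewrite ec (negPf vN) in cC.
have onr T c : is_support T -> c \in central M2 -> gr c \in T ->
    exists S, [/\ is_support S, c \in S & T = gr @: S].
  move=> /glue_support[[S supS ->]|[S supS ->]] cC; last first.
    by rewrite mem_imset // => cS; exists S.
  by case/imsetP=> w _ /esym/glue_left_right[_ ec]; rewrite ec (negPf xN) in cC.
have edges (u w : glue v x) : u -- w -> exists T : {set glue v x},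
    [/\ is_support T, u \in T & w \in T].
  have edger a b : gr a -- gr b -> exists T : {set glue v x}, [/\ is_support T, gr a \in T & gr b \in T].
    rewrite glue_right_edge => /(system_edge S2)[S [supS aS bS]].
    by exists (gr @: S); rewrite !imset_f //; split=> //; apply: supr.
  have base : gl v = gr x by rewrite /gr glue_right_base.
  case: (glueP u) => [a|a na]; case: (glueP w) => [b|b nb].
  - rewrite glue_left_edge => /(system_edge S1)[S [supS aS bS]].
    by exists (gl @: S); rewrite !imset_f //; split=> //; apply: supl.
  - move=> uw; have := uw; rewrite glue_cross_edge // => /andP[/eqP ea _].
    by move: uw; rewrite ea -/gl base; apply: edger.
  - move=> uw; have := uw; rewrite sedge_sym glue_cross_edge // => /andP[/eqP eb _].
    by move: uw; rewrite eb -/gl base; apply: edger.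
  exact: edger.
have hitting (X : {set glue v x}) : #|X| <= k1 + k2 ->
    (forall T : {set glue v x}, is_support T -> ~~ [disjoint T & X]) -> X = C.
  move=> leX hit; pose X1 := gl @^-1: X; pose X2 := gr @^-1: X.
  have hit1 T : is_support T -> ~~ [disjoint T & X1].
    move/supl/hit; rewrite -!setI_eq0 => /set0Pn[z /setIP[/imsetP[u uT ->] uX]].
    by apply/set0Pn; exists u; rewrite !inE uT.
  have hit2 T : is_support T -> ~~ [disjoint T & X2].
    move/supr/hit; rewrite -!setI_eq0 => /set0Pn[z /setIP[/imsetP[u uT ->] uX]].
    by apply/set0Pn; exists u; rewrite !inE uT.
  have h1 : #|X1| <= k1 -> X1 = central M1 by move=> le; apply: (system_hitting S1).
  have h2 : #|X2| <= k2 -> X2 = central M2 by move=> le; apply: (system_hitting S2).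
  have eX : gl @: X1 :|: gr @: X2 = X.
    apply/setP=> z; rewrite inE; case: (glueP z) => [u|w _].
      rewrite mem_imset // inE; case: imsetP => [[w + ew]|_]; last by rewrite orbF.
      by rewrite inE /gl ew orbT => ->.
    rewrite orbC mem_imset // inE; case: imsetP => [[u + eu]|_]; last by rewrite orbF.
    by rewrite inE /gr eu orbT => ->.
  (* The identified vertex has a preimage on each side and is counted twice when it lies in [X]. *)
  have cardX : #|X1| + #|X2| = #|X| + (gl v \in X).
    rewrite -(card_imset _ injl) -(card_imset _ injr) -cardsUI eX; congr (_ + _).
    have sub z : z \in gl @: X1 :&: gr @: X2 -> z = gl v.
      by case/setIP=> /imsetP[u _ ->] /imsetP[w _ /glue_left_right[-> _]].
    have [vX|vNX] := boolP (gl v \in X).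
      rewrite (_ : _ :&: _ = [set gl v]) ?cards1 //; apply/setP=> z; rewrite [RHS]inE.
      apply/idP/eqP=> [/sub//|->]; rewrite inE mem_imset // inE vX /=.
      by apply/imsetP; exists x; rewrite ?inE /gr glue_right_base.
    rewrite (_ : _ :&: _ = set0) ?cards0 //; apply/setP=> z; rewrite [RHS]inE.
    apply/negP=> zI; have /setIP[/imsetP[u + ez] _] := zI.
    by rewrite inE -ez (sub z zI) (negPf vNX).
  have vX1 : (v \in X1) = (gl v \in X) by rewrite inE.
  have xX2 : (x \in X2) = (gl v \in X) by rewrite inE /gr glue_right_base.
  (* A side within its bound equals its set of centres, which misses the identified vertex; so
     nothing is counted twice, and the other side is within its bound as well. If both sides
     exceeded their bounds, [X] would have more than k1 + k2 elements even after one double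
     count. *)
  have [le1|gt1] := leqP #|X1| k1.
    have e1 := h1 le1; move: vX1; rewrite e1 (negPf vN) => /esym vX; rewrite vX in cardX.
    have e2 : X2 = central M2 by apply: h2; move: cardX; rewrite e1 (card_central S1); lia.
    by rewrite eC -e1 -e2 eX.
  have [le2|gt2] := leqP #|X2| k2; last by move: cardX; case: (_ \in X); lia.
  have e2 := h2 le2; move: xX2; rewrite e2 (negPf xN) => /esym vX; rewrite vX in cardX.
  by move: cardX; rewrite e2 (card_central S2); lia.
split=> /=.
- rewrite eC cardsU !card_imset // (card_central S1) (card_central S2).
  rewrite (_ : _ :&: _ = set0) ?cards0 ?subn0 //.
  apply/setP=> z; rewrite !inE; apply/andP=> -[/imsetP[u uC ->] /imsetP[w _]].
  by case/glue_left_right=> eu _; rewrite eu (negPf vN) in uC.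
- move=> T /glue_support[] [S supS ->].
    have [S3 [c eS]] := system_triangle S1 supS; rewrite card_imset //; split=> //.
    exists (gl c); rewrite -imset_set1 -eS; apply/setP=> z; rewrite inE.
    apply/andP/imsetP=> [[/imsetP[u uS ->]]|[u /setIP[uS uC] ->]].
      by rewrite Cl => uC; exists u; rewrite // inE uS.
    by rewrite imset_f // Cl.
  have [S3 [c eS]] := system_triangle S2 supS; rewrite card_imset //; split=> //.
  exists (gr c); rewrite -imset_set1 -eS; apply/setP=> z; rewrite inE.
  apply/andP/imsetP=> [[/imsetP[u uS ->]]|[u /setIP[uS uC] ->]].
    by rewrite Cr => uC; exists u; rewrite // inE uS.
  by rewrite imset_f // Cr.
- exact: edges.
- move=> T1 T2 T3 c s1 s2 s3; rewrite eC => /setUP[]/imsetP[d dC ->] c1 c2 c3.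
    have [U1 [u1 d1 ->]] := onl T1 d s1 dC c1; have [U2 [u2 d2 ->]] := onl T2 d s2 dC c2.
    have [U3 [u3 d3 ->]] := onl T3 d s3 dC c3.
    by case: (system_central S1 u1 u2 u3 dC d1 d2 d3) => ->; by [constructor 1|constructor 2|constructor 3].
  have [U1 [u1 d1 ->]] := onr T1 d s1 dC c1; have [U2 [u2 d2 ->]] := onr T2 d s2 dC c2.
  have [U3 [u3 d3 ->]] := onr T3 d s3 dC c3.
  by case: (system_central S2 u1 u2 u3 dC d1 d2 d3) => ->; by [constructor 1|constructor 2|constructor 3].
exact: hitting.
Qed.

Lemma extremal_notin_central (x : butterfly) :
  x \in butterfly_extremal -> x \notin butterfly_central.
Proof. by rewrite !inE => /eqP->. Qed.

Lemma K3_connected_in (A : {set complete_graph 3}) : connected_in A.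
Proof.
move=> u v uA vA; have [->//|uv] := eqVneq u v.
by apply: connect1; rewrite /restricted_edge /= uA vA !andbT.
Qed.

Lemma K3_connected : connected (complete_graph 3).
Proof.
split; first by rewrite card_ord.
by move=> u v; have [->//|uv] := eqVneq u v; apply: connect1.
Qed.

Lemma K3_cactus : cactus (complete_graph 3).
Proof.
(* [cycle_graph 0] has three vertices; the whole triangle is nonseparable, hence the only block. *)
move=> B [_ maxB]; constructor 3; exists 0.
have nsT : nonseparable (induced (setT : {set complete_graph 3})).
  apply: nonseparableI; try by move=> *; apply: K3_connected_in.
  by apply/set0Pn; exists ord0; rewrite inE.
have {B maxB} <- := maxB _ (subsetT _) nsT.
pose f (u : induced [set: complete_graph 3]) : cycle_graph 0 := val u.
exists f.
  by exists (fun i => exist _ i (in_setT i)) => // u; apply: val_inj.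
move=> u v; rewrite /= /induced_edge /= /complete_edge /f -!val_eqE /=.
by case: (val u) => [[|[|[|i]]] ?]; case: (val v) => [[|[|[|j]]] ?].
Qed.

Lemma K3_neighbor (a : complete_graph 3) : exists b, a -- b.
Proof.
have [->|na] := eqVneq a ord0; last by exists ord0.
by exists (inord 1); rewrite /= /complete_edge -val_eqE /= inordK.
Qed.

Lemma glue_neighbor (G H : sgraph) (x : G) (y : H) :
  (forall u : G, exists v, u -- v) -> (forall u : H, exists v, u -- v) ->
  forall u : glue x y, exists v, u -- v.
Proof.
move=> nG nH u; case: (glueP u) => [a|a _].
  by have [b ab] := nG a; exists (glue_left x y b).
by have [b ab] := nH a; exists (glue_right x y b); rewrite glue_right_edge.
Qed.

Lemma central_attach (M : marked_graph) (v : M) (x : butterfly) : x \notin butterfly_central ->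
  central (attach_butterfly v x) =
  glue_left v x @: central M :|: glue_right v x @: butterfly_central :> {set glue v x}.
Proof.
move=> xN; apply/setP=> u; rewrite [LHS]inE in_setU; case: (glueP u) => [a|b nb].
  rewrite (mem_imset _ _ (@glue_left_inj _ _ v x)) /=.
  case: imsetP => [[w wC e]|_]; last by rewrite orbF.
  by have [_ ew] := @glue_left_right M butterfly v x _ _ e; rewrite ew (negPf xN) in wC.
rewrite orbC (mem_imset _ _ (@glue_right_inj _ _ v x)).
case: imsetP => [[w wC e]|_]; last by rewrite orbF glue_right_sub.
by have [_ eb] := @glue_left_right M butterfly v x _ _ (esym e); rewrite eb eqxx in nb.
Qed.

Lemma butterfly_constructionP k (M : marked_graph) : butterfly_construction k M ->
  [/\ connected M, cactus M, forall u : M, exists v, u -- v & triangle_system k M].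
Proof.
have conZ : connected butterfly by apply: glue_connected; apply: K3_connected.
have cacZ : cactus butterfly by apply: glue_cactus; apply: K3_cactus.
have nbrZ : forall u : butterfly, exists v, u -- v by apply: glue_neighbor; apply: K3_neighbor.
elim=> [|{}k {}M v x _ [conM cacM nbrM sysM] vN /extremal_notin_central xN].
  split=> //; exact: triangle_system_butterfly.
split; [exact: glue_connected | exact: glue_cactus | exact: glue_neighbor |].
rewrite -addn1; apply: (triangle_system_glue sysM triangle_system_butterfly vN xN).
exact: central_attach.
Qed.

Section SystemObstruction.
Variables (k : nat) (M : marked_graph).
Hypothesis sysM : triangle_system k.+1 M.
Hypothesis nbrM : forall u : M, exists v, u -- v.

(** A set [X] of at most k vertices is not the set of centres, so it misses a triangle [T1]. Adding
    a non-central vertex [y] of [T1] gives at most k + 1 vertices, again not the centres; the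
    triangle missed now avoids [y] and so differs from [T1]. *)
Lemma system_not_apex : ~ apex k sub_unicyclic M.
Proof.
apply: not_apexI => X leX.
have meet (Y : {set M}) : #|Y| <= k.+1 -> Y != central M ->
    exists2 T, is_support T & [disjoint T & Y].
  move=> leY /eqP neq; apply: NNPP => none; apply: neq; apply: (system_hitting sysM) => // T supT.
  by apply/negP=> dT; apply: none; exists T.
have [T1 sup1 d1] : exists2 T, is_support T & [disjoint T & X].
  apply: meet; first exact: leqW.
  by apply: contraTneq leX => ->; rewrite (card_central sysM) ltnn.
have [T13 [c ec]] := system_triangle sysM sup1.
have [y yT1 yN] : exists2 y, y \in T1 & y \notin central M.
  have : ~~ (T1 \subset central M).
    by apply/negP=> /setIidPl e; move: T13; rewrite -e ec cards1.
  by case/subsetPn=> y; exists y.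
have [T2 sup2] : exists2 T, is_support T & [disjoint T & y |: X].
  apply: meet; first by rewrite cardsU1; case: (_ \notin _); lia.
  by apply: contraNneq yN => <-; rewrite setU11.
rewrite disjoint_sym => d2; exists T1, T2; split=> //.
  by rewrite disjoint_sym; apply: disjointWl d2; apply: subsetUr.
by apply: contraTneq yT1 => ->; rewrite (disjointFr d2) // setU11.
Qed.

(* Keeping a single centre c of the edge's triangle leaves only the two triangles at c. *)
Lemma system_edge_center (x y : M) : x -- y -> exists (T : {set M}) (X : {set M}),
  [/\ is_support T, x \in T, y \in T, #|X| <= k
    & forall T1 T2, is_support T1 -> is_support T2 -> [disjoint T1 & X] -> [disjoint T2 & X] ->
      [\/ T1 = T, T2 = T | T1 = T2]].
Proof.
move=> /(system_edge sysM)[T [supT xT yT]]; have [_ [c ec]] := system_triangle sysM supT.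
have /setIP[cT cC] : c \in T :&: central M by rewrite ec set11.
exists T, (central M :\ c); split=> //.
  by have := cardsD1 c (central M); rewrite (card_central sysM) cC; lia.
have inc T' : is_support T' -> [disjoint T' & central M :\ c] -> c \in T'.
  move=> supT' dT'; have [_ [c' ec']] := system_triangle sysM supT'.
  have /setIP[c'T c'C] : c' \in T' :&: central M by rewrite ec' set11.
  have := disjointFr dT' c'T; rewrite !inE c'C andbT => /negbFE/eqP <-.
  exact: c'T.
move=> T1 T2 sup1 sup2 /(inc _ sup1) c1 /(inc _ sup2) c2.
by case: (system_central sysM sup1 sup2 supT cC c1 c2 cT) => e;
  [constructor 3 | constructor 1 | constructor 2].
Qed.

Lemma system_obs : obs (apex k sub_unicyclic) M.
Proof.
apply: obs_apexI => // [|x y xy|x y xy]; first exact: system_not_apex.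
  have [T [X [supT xT yT leX two]]] := system_edge_center xy.
  apply/apexP; exists X => // c1 c2 cyc1 cyc2 d1 d2.
  have [cy1 e1] := cycle_of_delete_edge cyc1; have [cy2 e2] := cycle_of_delete_edge cyc2.
  have sup1 : is_support (G := M) [set z in c1] by exists c1.
  have sup2 : is_support (G := M) [set z in c2] by exists c2.
  (* A cycle with vertex set [T] uses all pairs in [T], including the deleted one. *)
  have notT (c : seq M) : is_cycle c -> [set x; y] \notin cycle_edges c -> [set z in c] <> T.
    move=> cyc eN ec; case/negP: eN; rewrite triangle_edges ?ec //; last first.
      by have [] := system_triangle sysM supT.
    have xNy : x != y by apply: contraTneq xy => ->; rewrite sedge_irrefl.
    rewrite inE cards2 xNy andbT.
    by apply/subsetP=> z; rewrite !inE => /orP[]/eqP->.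
  case: (two [set z in c1] [set z in c2]); rewrite ?disjoint_supp //.
  - by move/notT; case.
  - by move/notT; case.
  by apply: eq_triangle_edges => //; have [] := system_triangle sysM sup1.
have [T [X [supT xT yT leX two]]] := system_edge_center xy.
apply/apexP; exists (contract_map xy @: X).
  exact: leq_trans (leq_imset_card _ _) leX.
move=> c1 c2 cyc1 cyc2 d1 d2.
have [e1 [cye1 <- s1]] := contract_cycle_lift xy cyc1.
have [e2 [cye2 <- s2]] := contract_cycle_lift xy cyc2.
have off (c : seq (contract x y)) (e : seq M) :
    contract_map xy @: [set z in e] = [set z in c] ->
    [disjoint c & contract_map xy @: X] -> [disjoint [set z in e] & X].
  move=> se; rewrite -disjoint_supp -se => d; rewrite -setI_eq0; apply/set0Pn=> -[z /setIP[ze zX]].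
  by have := disjointFr d (imset_f (contract_map xy) ze); rewrite imset_f.
(* The contraction maps [T] onto at most two vertices, too few for a cycle. *)
have notT (c : seq (contract x y)) (e : seq M) : is_cycle c ->
    contract_map xy @: [set z in e] = [set z in c] -> [set z in e] <> T.
  move=> cyc se eT; have : 2 < #|[set z in c]| by rewrite card_cycle //; case: cyc.
  rewrite -se eT ltnNge => /negP; apply; have [T3 _] := system_triangle sysM supT.
  have le2 : #|T :\ y| <= 2 by have := cardsD1 y T; rewrite yT T3; lia.
  apply: leq_trans le2; apply: leq_trans (leq_imset_card (contract_map xy) _).
  apply: subset_leq_card; apply/subsetP=> _ /imsetP[z zT ->].
  have [->|zy] := eqVneq z y; last by apply: imset_f; rewrite !inE zy.
  rewrite contract_map_y -(contract_map_x xy) imset_f // !inE xT andbT.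
  exact: contract_neq xy.
have sup1 : is_support [set z in e1] by exists e1.
case: (two [set z in e1] [set z in e2]) => //.
- by exists e2.
- exact: off s1 d1.
- exact: off s2 d2.
- by move/(notT _ _ cyc1 s1).
- by move/(notT _ _ cyc2 s2).
move=> e12; congr contract_edges; apply: eq_triangle_edges => //.
by have [] := system_triangle sysM sup1.
Qed.

End SystemObstruction.

Lemma graph_iso_subgraph (G H : sgraph) : graph_iso G H -> subgraph G H.
Proof. by move=> [f bf fm]; exists f; [apply: bij_inj | move=> x y; rewrite fm]. Qed.

Lemma obs_iso k (G H : sgraph) : graph_iso G H ->
  obs (apex k sub_unicyclic) H -> obs (apex k sub_unicyclic) G.
Proof.
move=> iso [nH minH]; have iso' := graph_iso_sym iso; split.
  by move=> aG; apply: nH; apply: apex_subgraph aG; apply: graph_iso_subgraph.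
move=> K [[G' [f inj hom] con] niso]; apply: minH; split.
  exists G' => //; have [g injg homg] := graph_iso_subgraph iso.
  by exists (g \o f); [apply: inj_comp | move=> u v /hom/homg].
by move=> isoK; apply: niso; apply: graph_iso_trans iso'.
Qed.

Lemma connected_iso (G H : sgraph) : graph_iso G H -> connected H -> connected G.
Proof.
move=> iso [H0 con]; split; first by rewrite (card_graph_iso iso).
move=> x y; have [f [g fK gK] fm] := iso; rewrite -(fK x) -(fK y).
by apply: homo_connect; [move=> u v uv; rewrite -fm !gK | apply: con].
Qed.

Lemma cactus_iso (G H : sgraph) : graph_iso G H -> cactus H -> cactus G.
Proof.
move=> /graph_iso_sym[f [g fK gK] fm] cacH; apply: cactus_cover => B _.
exists H, f, (f @^-1: B); split=> //; first exact: can_inj fK.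
by apply: imset_preim => w _; exists (g w).
Qed.

Theorem theorem11 (k : nat) (G : sgraph) :
  [/\ connected G, obs (apex k sub_unicyclic) G & cactus G]
  <-> butterfly_cactus k.+1 G.
Proof.
split=> [[conG obsG cacG]|[M conM iso]]; first exact: connected_cactus_obstruction.
have [con cac nbr sys] := butterfly_constructionP conM.
split; [exact: connected_iso iso con | | exact: cactus_iso iso cac].
exact/(obs_iso iso)/system_obs.
Qed.
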